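(* Let $(\Gamma,G)\in\mathcal{OG}(4)$, let $x$ be a vertex, and suppose that $(\Gamma,G)$ has independent cyclic normal quotients $\Gamma_N\cong C_r$ and $\Gamma_M\cong C_s$, where $r\geq 3$, $s\geq 3$. Then $G_x\cong Z_2$, and the following hold. (a) At least one of $\Gamma_N,\Gamma_M$ is $G$-unoriented; say $\Gamma_N$ is $G$-unoriented. (b) $(\Gamma,G)$ is a normal cover of some $(\overline{\Gamma},\overline{G})\in\mathcal{OG}(4)$ which has independent cyclic normal quotients $\overline{\Gamma}_{\overline{N}}\cong C_r$ and $\overline{\Gamma}_{\overline{M}}\cong C_s$ such that $\overline{N}\cap\overline{M}=1$. (c) The pair $(\overline{\Gamma},\overline{G})$ is (up to isomorphism of graph-group pairs) as in one of the following lines: 1. $(\Gamma(r,s),G(r,s))$ with at least one of $r,s$ odd; 2. $(\Gamma^+(r,s),G^+(r,s))$ with $r,s$ both even; 3. $(\Gamma(r,s),H(r,s))$ with $r$ odd and $s$ even; 4. $(\Gamma(s,r),H(s,r))$ with $r$ even and $s$ odd; 5. $(\Gamma^+(r,s),H^+(r,s))$ with $r,s$ both even; 6. $(\Gamma_2(r,s),G_2(r,s))$ with $r,s$ both odd; and $\overline{\Gamma}_{\overline{M}}$ (and $\Gamma_M$) is oriented ($\overline{G}$-oriented, respectively $G$-oriented) if and only if line 1 or line 2 holds.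
   Context: $\mathcal{OG}(4)$ is the family of all pairs $(\Gamma,G)$ where $\Gamma$ is a finite simple connected undirected graph of valency $4$ and $G\leq\mathrm{Aut}(\Gamma)$ is a vertex-transitive and edge-transitive group of automorphisms with a specified $G$-orbit $\Delta$ on ordered pairs of vertices consisting of exactly one ordered pair $(x,y)$ for each edge $\{x,y\}$. The edge $\{x,y\}$ is oriented from $x$ to $y$ (written $x\rightarrow y$) if $(x,y)\in\Delta$. For $N\unlhd G$, the normal quotient $\Gamma_N$ is the graph whose vertices are the $N$-orbits on vertices, two distinct $N$-orbits $B,C$ being adjacent iff there is an edge $\{x,y\}$ of $\Gamma$ with $x\in B$, $y\in C$. There is a constant $\ell$, independent of the adjacent pair $B,C$, such that each vertex of $B$ is joined to exactly $\ell$ vertices of $C$; if $\ell=1$ then $(\Gamma,G)$ is called a normal cover of $(\Gamma_N,G/N)$ ($N=1$ is allowed). $C_r$ is a cycle of length $r\ge3$; a cyclic normal quotient is a normal quotient that is a cycle. It is $G$-oriented if it inherits a $G$-invariant edge-orientation (for adjacent $N$-orbits $B,C$ all edges of $\Gamma$ between $B$ and $C$ are oriented in the same direction), and $G$-unoriented otherwise. Two cyclic normal quotients $\Gamma_M,\Gamma_N$ are independent if $\Gamma_K$ is not a cycle, where $K=\tilde N\cap\tilde M$ and $\tilde N$, $\tilde M$ are the subgroups of all elements of $G$ fixing setwise each $N$-orbit, respectively each $M$-orbit. Pairs $(\Gamma,G)$, $(\Gamma',G')$ are isomorphic if there are a graph isomorphism $f:\Gamma\to\Gamma'$ and a group isomorphism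 $\varphi:G\to G'$ with $(x^g)f=(xf)^{g\varphi}$ for all vertices $x$ and $g\in G$. $Z_n$ is the cyclic group of order $n$. For integers $r,s\ge3$, $\Gamma(r,s)$ is the graph with vertex set $X=\mathbb{Z}_r\times\mathbb{Z}_s$ in which $(i,j)$ is adjacent to the four vertices $(i\pm1,j\pm1)$. If $r,s$ are both even, $X^+=\{(i,j)\in X : i,j \text{ of the same parity}\}$ and $\Gamma^+(r,s)$ is the subgraph of $\Gamma(r,s)$ induced on $X^+$. Define permutations of $X$: $\mu:(i,j)\mapsto(i+1,j)$, $\nu:(i,j)\mapsto(i,j+1)$, $\sigma:(i,j)\mapsto(-i,j)$, $\tau:(i,j)\mapsto(-i,-j)$. Define $G(r,s)=\langle\mu,\nu,\sigma\rangle$; for $s$ even, $H(r,s)=\langle\mu,\sigma\nu,\tau\rangle$; for $r,s$ both even, $G^+(r,s)=\langle\mu^2,\mu\nu,\sigma\rangle$ and $H^+(r,s)=\langle\mu^2,\sigma\mu\nu,\tau\rangle$, both restricted to $X^+$. The edge-orientation for $(\Gamma(r,s),G(r,s))$ is $(i,j)\rightarrow(i\pm1,j+1)$, restricted to $X^+$ for $(\Gamma^+(r,s),G^+(r,s))$. The edge-orientation for $(\Gamma(r,s),H(r,s))$ ($s$ even) is $(i,j)\rightarrow(i+1,j+(-1)^j)$ and $(i,j)\rightarrow(i-1,j-(-1)^j)$, restricted to $X^+$ for $(\Gamma^+(r,s),H^+(r,s))$. $\Gamma_2(r,s)$ is the standard double cover of $\Gamma(r,s)$: its vertex set is $X_2=\{(i,j)_\delta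 : (i,j)\in X,\delta\in\mathbb{Z}_2\}$, with $x_\delta,y_{\delta'}$ adjacent iff $\delta\neq\delta'$ and $x,y$ are adjacent in $\Gamma(r,s)$; its orientation is $(i,j)_\delta\rightarrow(i+1,j+(-1)^\delta)_{\delta+1}$ and $(i,j)_\delta\rightarrow(i-1,j-(-1)^\delta)_{\delta+1}$. $G_2(r,s)$ is the group generated by the permutations of $X_2$: $(i,j)_\delta\mapsto(i+1,j)_\delta$, $(i,j)_\delta\mapsto(i,j+1)_\delta$, $(i,j)_\delta\mapsto(i,-j)_{\delta+1}$, $(i,j)_\delta\mapsto(-i,-j)_\delta$. *)

(* Defs.v *)
From HB Require Import structures.
From mathcomp Require Import all_boot all_order all_fingroup all_algebra all_solvable.

Set Implicit Arguments.
Unset Strict Implicit.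
Unset Printing Implicit Defensive.

Import GroupScope GRing.Theory.

(* A graph-group pair (Gamma, G) together with the set Delta of arcs (ordered
   pairs of vertices) giving the edge-orientation. Permutations act on the
   right, as in mathcomp: (g * h) x = h (g x). *)
Record gpair := GPair {
  vert :> finType;
  adj : rel vert;
  grp : {group {perm vert}};
  arcs : {set vert * vert}
}.
Arguments adj {g} : rename.
Arguments grp : clear implicits.
Arguments arcs : clear implicits.

Section Pairs.
Variable P : gpair.

Definition edges : {set {set P}} :=
  [set [set p.1; p.2] | p in [set p : P * P | adj p.1 p.2]].

(* (Gamma, G) \in OG(4), for the orientation Delta = arcs P *)
Record OG4 : Prop := {
  og_sym : symmetric (@adj P);
  og_irr : irreflexive (@adj P);
  og_connected : forall x y : P, connect adj x y;
  og_valency : forall x : P, #|[set y | adj x y]| = 4%N;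
  og_aut : forall g : {perm P}, g \in grp P ->
    forall x y : P, adj (g x) (g y) = adj x y;
  og_vtrans : [transitive grp P, on [set: P] | 'P];
  og_etrans : [transitive grp P, on edges | 'P^*];
  og_arcs_orbit :
    exists x y : P, arcs P = [set ((g : {perm P}) x, g y) | g in grp P];
  og_arcs_adj : forall x y : P, (x, y) \in arcs P -> adj x y;
  og_arcs_one : forall x y : P,
    adj x y -> ((x, y) \in arcs P) (+) ((y, x) \in arcs P)
}.

Variable N : {set {perm P}}.

Definition orbs : {set {set P}} := orbit 'P N @: [set: P].

Definition qvert : finType := {B : {set P} | B \in orbs}.

Definition qadj : rel qvert := fun B C =>
  (B != C) && [exists x in val B, exists y in val C, adj x y].

Definition G_oriented : Prop := forall B C : qvert, qadj B C ->
     {in val B & val C, forall x y, adj x y -> (x, y) \in arcs P}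
  \/ {in val B & val C, forall x y, adj x y -> (y, x) \in arcs P}.

(* the subgroup of the elements of G fixing each N-orbit setwise *)
Definition orbker : {set {perm P}} := 'C_(grp P)(orbs | 'P^*).

(* the condition l = 1 *)
Definition ell_one : Prop := forall B C : qvert, qadj B C ->
  {in val B, forall x, #|[set y in val C | adj x y]| = 1%N}.

End Pairs.

Definition graph_isomorphic (T U : finType) (e : rel T) (e' : rel U) : Prop :=
  exists f : T -> U, bijective f /\ forall x y, e' (f x) (f y) = e x y.

(* the cycle C_r; only meaningful for 3 <= r *)
Definition cycle_rel (r : nat) : rel 'I_r := fun i j =>
  ((j : nat) == i.+1 %% r) || ((i : nat) == j.+1 %% r).

Section CyclicQuotients.
Variables (P : gpair) (N M : {group {perm P}}).

Definition quotient_cycle (K : {set {perm P}}) (r : nat) : Prop :=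
  graph_isomorphic (@qadj P K) (@cycle_rel r).

Definition independent : Prop :=
  ~ exists2 k, 3 <= k & quotient_cycle (orbker N :&: orbker M) k.

Definition independent_cyclic_quotients (r s : nat) : Prop :=
  [/\ N <| grp P, M <| grp P, quotient_cycle N r, quotient_cycle M s
    & independent].

End CyclicQuotients.

Definition pair_isomorphic (P Q : gpair) : Prop :=
  exists (f : P -> Q) (phi : {morphism grp P >-> {perm Q}}),
  [/\ bijective f,
      forall x y, adj (f x) (f y) = adj x y,
      isom (grp P) (grp Q) phi
    & forall (g : {perm P}) (x : P),
        g \in grp P -> f (g x) = phi g (f x)].

(* (Gamma, G) is a normal cover of a pair isomorphic to (Gamma_K, G / K), where
   the coset of g sends the K-orbit B to g @: B. *)
Definition normal_cover (P Q : gpair) : Prop :=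
  exists K : {group {perm P}},
  [/\ K <| grp P, ell_one K &
  exists (f : qvert K -> Q) (phi : {morphism grp P / K >-> {perm Q}}),
  [/\ bijective f,
      forall B C, adj (f B) (f C) = qadj B C,
      isom (grp P / K) (grp Q) phi
    & forall (g : {perm P}) (B C : qvert K),
        g \in grp P -> val C = g @: val B -> f C = phi (coset K g) (f B)]].

(* The vertex set 'Z_r * 'Z_s is Z_r x Z_s as soon as r, s >= 2. *)
Section Models.
Variables r s : nat.

Definition X : finType := ('Z_r * 'Z_s)%type.

Local Open Scope ring_scope.

Definition mu_fun (x : X) : X := (x.1 + 1, x.2).
Definition nu_fun (x : X) : X := (x.1, x.2 + 1).
Definition sigma_fun (x : X) : X := (- x.1, x.2).
Definition tau_fun (x : X) : X := (- x.1, - x.2).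

Lemma mu_inj : injective mu_fun.
Proof. by apply: (can_inj (g := fun x => (x.1 - 1, x.2))) => -[i j] /=; rewrite /mu_fun /= addrK. Qed.
Lemma nu_inj : injective nu_fun.
Proof. by apply: (can_inj (g := fun x => (x.1, x.2 - 1))) => -[i j] /=; rewrite /nu_fun /= addrK. Qed.
Lemma sigma_inj : injective sigma_fun.
Proof. by apply: inv_inj => -[i j]; rewrite /sigma_fun /= opprK. Qed.
Lemma tau_inj : injective tau_fun.
Proof. by apply: inv_inj => -[i j]; rewrite /tau_fun /= !opprK. Qed.

Definition mu : {perm X} := perm mu_inj.
Definition nu : {perm X} := perm nu_inj.
Definition sigma : {perm X} := perm sigma_inj.
Definition tau : {perm X} := perm tau_inj.

Definition adjX : rel X := fun x y =>
  ((y.1 == x.1 + 1) || (y.1 == x.1 - 1)) &&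
  ((y.2 == x.2 + 1) || (y.2 == x.2 - 1)).

Definition arcsG : {set X * X} :=
  [set a : X * X | ((a.2.1 == a.1.1 + 1) || (a.2.1 == a.1.1 - 1))
                   && (a.2.2 == a.1.2 + 1)].

(* For even s, (-1) ^+ j depends only on j modulo s. *)
Definition arcsH : {set X * X} :=
  [set a : X * X |
     (a.2 == (a.1.1 + 1, a.1.2 + (-1) ^+ (a.1.2 : nat)))
  || (a.2 == (a.1.1 - 1, a.1.2 - (-1) ^+ (a.1.2 : nat)))].

Definition pairG : gpair :=
  @GPair X adjX (<<[set mu; nu; sigma]>>)%G arcsG.

(* for s even *)
Definition pairH : gpair :=
  @GPair X adjX (<<[set mu; (sigma * nu)%g; tau]>>)%G arcsH.

Definition Xplus : pred X := fun x => odd x.1 == odd x.2.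

Definition Xp : finType := {x : X | Xplus x}.

Definition adjXp : rel Xp := fun x y => adjX (val x) (val y).

Definition restr_arcs (A : {set X * X}) : {set Xp * Xp} :=
  [set a : Xp * Xp | (val a.1, val a.2) \in A].

(* The restrictions to X^+ of those elements of A that preserve X^+. For even
   r, s every generator used below preserves X^+, so restricting the generators
   yields the restriction of the group they generate. *)
Definition restr_perms (A : {set {perm X}}) : {set {perm Xp}} :=
  [set p : {perm Xp} | [exists g in A, forall x, val (p x) == g (val x)]].

(* for r, s even *)
Definition pairGplus : gpair :=
  @GPair Xp adjXp
    (<<restr_perms [set (mu ^+ 2)%g; (mu * nu)%g; sigma]>>)%G
    (restr_arcs arcsG).

(* for r, s even *)
Definition pairHplus : gpair :=
  @GPair Xp adjXp
    (<<restr_perms [set (mu ^+ 2)%g; (sigma * mu * nu)%g; tau]>>)%G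
    (restr_arcs arcsH).

Definition X2 : finType := (X * 'Z_2)%type.

Definition adjX2 : rel X2 := fun x y => (x.2 != y.2) && adjX x.1 y.1.

Definition arcs2 : {set X2 * X2} :=
  [set a : X2 * X2 |
    let: ((i, j), d) := a.1 in
       (a.2 == ((i + 1, j + (-1) ^+ (d : nat)), d + 1))
    || (a.2 == ((i - 1, j - (-1) ^+ (d : nat)), d + 1))].

Definition mu2_fun (x : X2) : X2 := (mu_fun x.1, x.2).
Definition nu2_fun (x : X2) : X2 := (nu_fun x.1, x.2).
Definition sigma2_fun (x : X2) : X2 := ((x.1.1, - x.1.2), x.2 + 1).
Definition tau2_fun (x : X2) : X2 := (tau_fun x.1, x.2).

Lemma mu2_inj : injective mu2_fun.
Proof. by move=> [x d] [y e] h;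
rewrite (mu_inj (congr1 fst h) : x = y) (congr1 snd h : d = e). Qed.
Lemma nu2_inj : injective nu2_fun.
Proof. by move=> [x d] [y e] h;
rewrite (nu_inj (congr1 fst h) : x = y) (congr1 snd h : d = e). Qed.
Lemma sigma2_inj : injective sigma2_fun.
Proof. by apply: (can_inj (g := fun x : X2 => ((x.1.1, - x.1.2), x.2 - 1))) => -[[i j] d]; rewrite /sigma2_fun /= opprK addrK. Qed.
Lemma tau2_inj : injective tau2_fun.
Proof. by move=> [x d] [y e] h;
rewrite (tau_inj (congr1 fst h) : x = y) (congr1 snd h : d = e). Qed.

Definition pair2 : gpair :=
  @GPair X2 adjX2
    (<<[set perm mu2_inj; perm nu2_inj; perm sigma2_inj; perm tau2_inj]>>)%G
    arcs2.

End Models.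

(* table_line r s k L: L is the pair in line k of the list for (r, s). Different
   lines may be isomorphic as pairs: lines 2 and 5 are when s = 4 and 4 %| r. *)
Variant table_line (r s : nat) : nat -> gpair -> Prop :=
| Line1 : odd r || odd s -> table_line r s 1 (pairG r s)
| Line2 : ~~ odd r && ~~ odd s -> table_line r s 2 (pairGplus r s)
| Line3 : odd r && ~~ odd s -> table_line r s 3 (pairH r s)
| Line4 : ~~ odd r && odd s -> table_line r s 4 (pairH s r)
| Line5 : ~~ odd r && ~~ odd s -> table_line r s 5 (pairHplus r s)
| Line6 : odd r && odd s -> table_line r s 6 (pair2 r s).

(* Main.v *)
(* Label the N-orbits by Z_r and the M-orbits by Z_s, so that both coordinates
   c1, c2 change by +-1 along every edge. A coordinate is either oriented (its
   change is constant along all arcs) or unoriented (the two out-neighbours of a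
   vertex change it in opposite ways, and so do its two in-neighbours).

   If two neighbours of some vertex agree in both coordinates, then, by
   transitivity, c2 - c2 x0 = +-(c1 - c1 x0) with a constant sign, the image of
   (c1, c2) is a diagonal, and the orbits of the intersection K of the two
   kernels form a cycle of length lcm r s. So independence forces the four
   neighbours of (i, j) to lie over the four pairs (i +- 1, j +- 1); in
   particular c1 and c2 are not both oriented. A permutation that preserves the
   arcs and the fibres of an unoriented coordinate is determined by its effect on
   one arc, whence G_x = Z_2.

   Let c1 be unoriented. If c2 is oriented, K-orbits are the fibres of (c1, c2),
   and the image of (c1, c2) is Z_r x Z_s or its even part: lines 1 and 2. If c2
   is unoriented, the out-neighbours of x lie over
   (c1 x, c2 x) +- (1, (-1)^t) for a type t = t(x) that changes along each
   edge, and K-orbits are the fibres of (c1, c2, t). When s (or r) is even, t is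
   the parity of c2 (or c1), which gives lines 3, 4 and 5; when both are odd we
   get the double cover of line 6. The group is identified by semiregularity:
   two arc-transitive groups which both preserve the arcs and the fibres of c1
   coincide. *)
Require Import Defs.
From mathcomp Require Import all_boot all_order all_fingroup all_algebra all_solvable.

Set Implicit Arguments.
Unset Strict Implicit.
Unset Printing Implicit Defensive.

Import GroupScope GRing.Theory.

(* mathcomp's quotient.v has a lemma of the same name. *)
Local Notation quotient_cycle := Defs.quotient_cycle.

(** * Signs in Z_r *)

Section Signs.
Local Open Scope ring_scope.
Variable r : nat.

(** A step along the cycle is stored as a boolean, [false] for +1 and [true] for -1, so that
    reversing a step is [~~] and multiplying signs is [(+)]. *)
Definition sg (e : bool) : 'Z_r := (-1) ^+ e.

Lemma sgN e : sg (~~ e) = - sg e.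
Proof. by case: e; rewrite /sg ?expr0 ?expr1 ?opprK. Qed.

Lemma sgK (e : bool) (i j : 'Z_r) : i = j + sg e -> j = i + sg (~~ e).
Proof. by move=> ->; rewrite sgN addrK. Qed.

Lemma sg_mul e e' : sg e * sg e' = sg (e (+) e').
Proof. by rewrite /sg signr_addb. Qed.

Hypothesis r3 : (3 <= r)%N.

(** The difference of the two signs is twice a unit, and 2 is nonzero modulo r because r >= 3. This
    keeps the two neighbours of a vertex of the cycle apart. *)
Lemma sg_neqN e : sg (~~ e) != sg e.
Proof.
rewrite sgN eq_sym -addr_eq0.
have -> : sg e + sg e = sg e * 2%:R by rewrite mulr_natr mulr2n.
rewrite mulrI_eq0; last by apply: mulrI; rewrite unitrX ?unitrN ?unitr1.
by apply/eqP => /(congr1 (@nat_of_ord _)); rewrite val_Zp_nat ?modn_small // ltnW.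
Qed.

Lemma sg_inj : injective sg.
Proof.
by case=> [] [] // h; [have := sg_neqN false | have := sg_neqN true];
  rewrite /= h eqxx.
Qed.

Lemma sg_neq (i : 'Z_r) e e' : i + sg e = i + sg e' -> e = e'.
Proof. by move/addrI/sg_inj. Qed.

Lemma sg_alt e e' : sg e' != sg e -> e' = ~~ e.
Proof. by case: e e' => [] [] //; rewrite eqxx. Qed.

End Signs.
Arguments sg {r}.

(** * Arcs and arc-transitivity *)

(** The direction is a parameter, [true] for out-neighbours and [false] for in-neighbours, so that
    one argument treats both. *)
Definition darc (P : gpair) (d : bool) (x y : P) :=
  if d then (x, y) \in arcs P else (y, x) \in arcs P.
Arguments darc {P}.

Section Pair.
Variable P : gpair.
Hypothesis HP : OG4 P.
Local Notation G := (grp P).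

Lemma darcN d (x y : P) : darc (~~ d) x y = darc d y x.
Proof. by case: d. Qed.

Lemma darc_adj d (x y : P) : darc d x y -> adj x y.
Proof.
case: d => /(og_arcs_adj HP) //; by rewrite (og_sym HP).
Qed.

Lemma adj_darc (x y : P) : adj x y -> exists d, darc d x y.
Proof.
move=> /(og_arcs_one HP); case E: (_ \in _) => /=; first by exists true.
by exists false.
Qed.

Lemma darcNC d (x y : P) : darc d x y -> ~~ darc (~~ d) x y.
Proof.
move=> h; have := og_arcs_one HP (darc_adj h).
by case: d h => /= ->; rewrite /= ?addbT.
Qed.

Lemma darc_adjE d (x y : P) : adj x y -> darc (~~ d) x y = ~~ darc d x y.
Proof.
move=> /(og_arcs_one HP); case: d => /=.
  by case: (_ \in _); case: (_ \in _).
by case: (_ \in _); case: (_ \in _).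
Qed.

Lemma darc_grp g d (x y : P) : g \in G -> darc d (g x) (g y) = darc d x y.
Proof.
have [x0 [y0 arcsE]] := og_arcs_orbit HP.
have imp h u v : h \in G -> (u, v) \in arcs P -> (h u, h v) \in arcs P.
  move=> hG; rewrite arcsE => /imsetP[k kG [-> ->]].
  by apply/imsetP; exists (k * h); rewrite ?groupM // !permM.
move=> gG; suff eqg u v : ((g u, g v) \in arcs P) = ((u, v) \in arcs P).
  by case: d => /=.
apply/idP/idP; last exact: imp.
by move/(imp g^-1 _ _ (groupVr gG)); rewrite !permK.
Qed.

Lemma arc_trans d (x y x' y' : P) : darc d x y -> darc d x' y' ->
  exists2 g, g \in G & g x = x' /\ g y = y'.
Proof.
have [x0 [y0 arcsE]] := og_arcs_orbit HP.
suff H u v u' v' : (u, v) \in arcs P -> (u', v') \in arcs P ->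
    exists2 g, g \in G & g u = u' /\ g v = v'.
  case: d => /= h1 h2; first exact: H.
  by have [g gG []] := H _ _ _ _ h1 h2; exists g.
rewrite arcsE => /imsetP[g gG [-> ->]] /imsetP[h hG [-> ->]].
by exists (g^-1 * h); rewrite ?groupM ?groupV // !permM !permK.
Qed.

Lemma vert_trans (x y : P) : exists2 g, g \in G & g x = y.
Proof.
have /orbitP[g gG <-] : y \in orbit 'P G x.
  by rewrite (atransP (og_vtrans HP) x) ?inE.
by exists g.
Qed.

Lemma conn_ind (S : P -> Prop) (x : P) : S x ->
  (forall y z, S y -> adj y z -> S z) -> forall y, S y.
Proof.
move=> Sx clS y; have /connectP[p] := og_connected HP x y.
elim: p x Sx => [|z p IH] x Sx /=; first by move=> _ ->.
by case/andP => /(clS _ _ Sx)/IH h /h{}h /h.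
Qed.

(** Vertex-transitivity makes out-degree and in-degree constant; counting the arcs by tail and by
    head shows that they are equal, and they add up to 4. *)
Lemma dir_two d (x : P) : exists y z, [/\ y != z, darc d x y, darc d x z &
  forall w, darc d x w -> w = y \/ w = z].
Proof.
pose A d x := [set y : P | darc d x y].
have cardA e y z : #|A e y| = #|A e z|.
  have [g gG <-] := vert_trans y z.
  rewrite -(card_imset _ (@perm_inj _ g)); congr #|pred_of_set _|.
  apply/setP=> w; rewrite -[w](permKV g) mem_imset; last exact: perm_inj.
  by rewrite !inE darc_grp.
have sumA : \sum_y #|A true y| = \sum_y #|A false y|.
  transitivity (\sum_(y : P) \sum_(z : P | darc true y z) 1).
    by apply: eq_bigr => y _; rewrite sum1dep_card.
  rewrite (exchange_big_dep xpredT) //=.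
  by apply: eq_bigr => y _; rewrite sum1dep_card.
have eqA : #|A true x| = #|A false x|.
  move: sumA; rewrite (eq_bigr _ (fun y _ => cardA true y x)).
  rewrite (eq_bigr _ (fun y _ => cardA false y x)) !sum_nat_const.
  by move/eqP; rewrite eqn_pmul2l => [/eqP//|]; apply/card_gt0P; exists x.
have sum4 : #|A true x| + #|A false x| = 4.
  rewrite -(og_valency HP x) -cardsUI.
  have -> : A true x :&: A false x = set0.
    by apply/setP=> y; rewrite !inE; apply/negP => /andP[/darcNC/negP].
  rewrite cards0 addn0; congr #|pred_of_set _|; apply/setP=> y; rewrite !inE.
  apply/orP/idP => [[]/darc_adj // | /adj_darc[[] ->]]; by [left | right].
have : #|A d x| == 2.
  have e2 : #|A false x| = 2.
    by move: sum4; rewrite eqA addnn -[4]/(2.*2) => /double_inj.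
  by case: d; rewrite ?eqA e2.
case/cards2P=> y [z [yz Ax]]; exists y, z.
have memA w : darc d x w = (w == y) || (w == z).
  by have := in_set2 w y z; rewrite -Ax inE.
split; rewrite // ?memA ?eqxx ?orbT // => w.
by rewrite memA => /orP[]/eqP->; [left | right].
Qed.

End Pair.

(** * Coordinates on a cyclic quotient *)

Section Coordinates.
Local Open Scope ring_scope.

(** An identification of the [N]-orbits with the vertices of the r-cycle, read on the vertices of
    the graph. The last clause provides both steps at every vertex, not just at some vertex of each
    orbit. *)
Definition is_coord (P : gpair) (N : {set {perm P}}) r (c : P -> 'Z_r) : Prop :=
  [/\ forall x y, (y \in orbit 'P N x) = (c x == c y),
      forall x y, adj x y -> exists e, c y = c x + sg e
    & forall x e, exists2 y, adj x y & c y = c x + sg e].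

Lemma sg_neq0 r e : sg e != 0 :> 'Z_r.
Proof. by rewrite signr_eq0. Qed.

Definition orb_vert (P : gpair) (N : {set {perm P}}) (x : P) : qvert N :=
  exist _ (orbit 'P N x) (imset_f (orbit 'P N) (in_setT x)).

Lemma cycle_relE r (i j : 'Z_r.+3) :
  @cycle_rel r.+3 i j <-> exists e, j = i + sg e.
Proof.
have succE (k l : 'Z_r.+3) : ((l : nat) == k.+1 %% r.+3)%N = (l == k + 1).
  by rewrite -(inj_eq val_inj) /= modnDmr addn1.
rewrite /cycle_rel !succE; split.
  by case/orP => /eqP ->; [exists false | exists true; rewrite /sg expr1 addrK].
by case=> [[]] ->; rewrite /sg ?expr1 ?expr0 ?subrK ?eqxx ?orbT.
Qed.

Lemma coord_surj (P : gpair) (N : {set {perm P}}) r (c : P -> 'Z_r) :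
  (1 < r)%N -> is_coord N c -> P -> forall i, exists x, c x = i.
Proof.
move=> r1 [_ _ cS] x0 i.
have H n : exists x, c x = c x0 + n%:R.
  elim: n => [|n [x cx]]; first by exists x0; rewrite addr0.
  have [y _ cy] := cS x false; exists y.
  by rewrite cy cx -addrA /sg expr0 mulrSr.
have [x cx] := H (nat_of_ord (i - c x0)); exists x.
by rewrite cx natr_Zp addrC subrK.
Qed.

(** The coordinate is constant on orbits and separates them, and repeated +1 steps reach every
    value; so it descends to a bijection onto the cycle. *)
Lemma coord_cycle (P : gpair) (N : {set {perm P}}) r (c : P -> 'Z_r) :
  (3 <= r)%N -> P -> is_coord N c -> quotient_cycle N r.
Proof.
case: r c => [|[|[|r]]] // c _ x0 Hc.
have [cN cadj cS] := Hc.
have valE (B : qvert N) x y : x \in val B -> (y \in val B) = (c x == c y).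
  by case/imsetP: (valP B) => z _ ->; rewrite !cN => /eqP ->.
have inh (B : qvert N) : exists x, x \in val B.
  by case/imsetP: (valP B) => z _ ->; exists z; rewrite cN.
pose F (B : qvert N) : 'I_r.+3 := c (odflt x0 [pick x in val B]).
have FE (B : qvert N) x : x \in val B -> F B = c x.
  move=> xB; rewrite /F; case: pickP => [y yB|/(_ x)]; last by rewrite xB.
  by apply/eqP; rewrite -(valE B).
have F_inj : injective F.
  move=> B C eqF; apply: val_inj; apply/setP=> y.
  have [x xB] := inh B; have [z zC] := inh C.
  by rewrite (valE _ _ _ xB) (valE _ _ _ zC) -(FE _ _ xB) eqF (FE _ _ zC).
have F_surj i : exists B, F B = i.
  have [x <-] := @coord_surj P N r.+3 c isT Hc x0 i.
  by exists (orb_vert N x); apply: FE; rewrite cN.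
exists F; split.
  have F_surjb i : exists B, F B == i by have [B /eqP] := F_surj i; exists B.
  exists (fun i => xchoose (F_surjb i)) => [B|i].
    by apply: F_inj; apply/eqP; apply: xchooseP (F_surjb _).
  by apply/eqP; apply: xchooseP (F_surjb _).
move=> B C; apply/idP/idP.
  move/cycle_relE => [e FC]; have [x xB] := inh B; have [z zC] := inh C.
  have [y xy cy] := cS x e.
  have yC : y \in val C.
    by rewrite (valE _ _ _ zC) -(FE _ _ zC) FC (FE _ _ xB) cy.
  apply/andP; split.
    apply/eqP => BC; move: FC; rewrite BC -[LHS]addr0 => /addrI/esym/eqP.
    by rewrite (negPf (sg_neq0 _ _)).
  by apply/existsP; exists x; rewrite xB; apply/existsP; exists y; rewrite yC.
case/andP=> _ /existsP[x /andP[xB /existsP[y /andP[yC xy]]]].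
apply/cycle_relE; rewrite (FE _ _ xB) (FE _ _ yC); exact: cadj.
Qed.

(** [qadj] relates only distinct orbits, so the isomorphism with the cycle controls an edge once
    edges inside an orbit are excluded. *)
Lemma cycle_coord (P : gpair) (N : {group {perm P}}) r :
  OG4 P -> (3 <= r)%N -> N \subset grp P ->
  (forall x y : P, adj x y -> y \notin orbit 'P N x) ->
  quotient_cycle N r -> exists c : P -> 'Z_r, is_coord N c.
Proof.
move=> HP; case: r => [|[|[|r]]] // _ sNG noedge [f [bf fadj]].
pose Q x := orb_vert N x.
have QE (B : qvert N) x : x \in val B -> B = Q x.
  move=> xB; apply: val_inj; case/imsetP: (valP B) xB => z _ ->.
  by move=> /orbit_eqP.
have f_inj : injective f := bij_inj bf.
exists (fun x => f (Q x)); split.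
- move=> x y; rewrite (inj_eq f_inj); apply/idP/eqP => [yx|[/setP/(_ y)]].
    by rewrite -(QE (Q x) y).
  by rewrite orbit_refl.
- move=> x y xy; apply/cycle_relE; rewrite fadj; apply/andP; split.
    apply/eqP => [[/setP/(_ y)]]; rewrite orbit_refl.
    by apply/negP; apply: noedge.
  apply/existsP; exists x; rewrite orbit_refl; apply/existsP; exists y.
  by rewrite orbit_refl.
- move=> x e; have [g fK gK] := bf.
  pose i : 'Z_r.+3 := f (Q x); pose C := g (i + sg e).
  have : qadj (Q x) C.
    by rewrite -fadj; apply/cycle_relE; exists e; rewrite gK.
  case/andP => _ /existsP[x' /andP[/orbitP[n nN <-] /existsP[y' /andP[yC xy]]]].
  (* The given edge between the two orbits starts at [n x]; translating it back by [n] makes it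
     start at [x]. *)
  exists (n^-1%g y').
    by rewrite -(og_aut HP (subsetP sNG _ nN)) permKV.
  rewrite -[RHS]gK -/C; congr f; apply/esym/QE.
  case/imsetP: (valP C) yC => z _ -> yz.
  by rewrite -(orbit_transl (y := y')) // orbit_sym; apply: mem_orbit;
    rewrite groupV.
Qed.

End Coordinates.

Definition oriented (P : gpair) r (c : P -> 'Z_r) : Prop :=
  exists e, forall x y, darc true x y -> c y = (c x + sg e)%R.

(** The final clause lets a neighbour of [x] be recovered from its direction and its coordinate,
    which drives the rigidity arguments. *)
Definition unoriented (P : gpair) r (c : P -> 'Z_r) : Prop :=
  forall x d e, exists y, [/\ darc d x y, c y = (c x + sg e)%R &
    forall y', darc d x y' -> c y' = c y -> y' = y].

Section CoordinateSteps.
Local Open Scope ring_scope.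
Variables (P : gpair) (N : {set {perm P}}) (r : nat) (c : P -> 'Z_r).
Hypothesis Hc : is_coord N c.

Lemma coord_step x y : adj x y -> exists e, c y = c x + sg e.
Proof. by case: Hc => _ + _; apply. Qed.

Lemma coord_two x y y' e : adj x y -> adj x y' -> c y = c x + sg e ->
  c y' <> c y -> c y' = c x + sg (~~ e).
Proof.
move=> _ /coord_step[e' ->] -> ne; congr (_ + sg _).
by apply: (@sg_alt r); apply/eqP => h; apply: ne; rewrite h.
Qed.

End CoordinateSteps.

(** * Kernel, rigidity and orientation dichotomy for one coordinate *)

Section OneCoordinate.
Local Open Scope ring_scope.
Variables (P : gpair) (N : {group {perm P}}) (r : nat).
Hypotheses (HP : OG4 P) (r3 : (3 <= r)%N) (nNG : N <| grp P).
Local Notation G := (grp P).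

Lemma orbit_grp g x y : g \in G ->
  y \in orbit 'P N x -> g y \in orbit 'P N (g x).
Proof.
move=> gG /orbitP[n nN <-]; apply/orbitP; exists (n ^ g)%g.
  by rewrite memJ_norm // (subsetP (normal_norm nNG)).
by rewrite /= /aperm !permM permK.
Qed.

(** If one edge lies inside an orbit, arc-transitivity (up to reversal) puts every edge inside an
    orbit; by connectedness there is a single orbit, too few for a cycle. *)
Lemma cycle_no_edge : quotient_cycle N r ->
  forall x y : P, adj x y -> y \notin orbit 'P N x.
Proof.
case: r r3 => [|[|[|r']]] // _ [f [[g fK gK] _]] x y xy; apply/negP => yx.
have all_edges u v : adj u v -> v \in orbit 'P N u.
  have [d dxy] := adj_darc HP xy => uv; have [d' duv] := adj_darc HP uv.
  have [dd|dd] := eqVneq d' d.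
    rewrite dd in duv; have [h hG [<- <-]] := arc_trans HP dxy duv.
    exact: orbit_grp.
  have dvu : darc d v u by rewrite -darcN; case: d d' dd duv {dxy} => [] [].
  have [h hG [<- <-]] := arc_trans HP dxy dvu.
  by rewrite orbit_sym; apply: orbit_grp.
have all_orb u : u \in orbit 'P N x.
  apply: (conn_ind HP (S := fun u => u \in orbit 'P N x) (x := x)) u.
    exact: orbit_refl.
  move=> u v ux uv; exact: orbit_trans (all_edges _ _ uv) ux.
have orbE (B C : qvert N) : B = C.
  apply: val_inj; case/imsetP: (valP B) => b _ ->; case/imsetP: (valP C) => c _ ->.
  apply/orbit_eqP; apply: orbit_trans (all_orb b) _.
  by rewrite orbit_sym.
by have := congr1 f (orbE (g ord0) (g ord_max)); rewrite !gK.
Qed.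

Variable c : P -> 'Z_r.
Hypothesis Hc : is_coord N c.

Lemma coord_grp g x y : g \in G -> (c (g x) == c (g y)) = (c x == c y).
Proof.
case: Hc => cN _ _ gG; rewrite -!cN; apply/idP/idP; last exact: orbit_grp.
by move/(orbit_grp (groupVr gG)); rewrite !permK.
Qed.

Lemma coord_eq g x y : g \in G -> c x = c y -> c (g x) = c (g y).
Proof. by move=> gG cxy; apply/eqP; rewrite coord_grp // cxy. Qed.

Lemma coord_fix n x : n \in N -> c (n x) = c x.
Proof.
by case: Hc => cN _ _ nN; apply/esym/eqP; rewrite -cN; apply: mem_orbit.
Qed.

Lemma coord_fib x y : c x = c y -> exists2 n, n \in N & n x = y.
Proof. by case: Hc => cN _ _ /eqP; rewrite -cN => /orbitP[n nN <-]; exists n. Qed.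

Lemma orbkerP g : reflect (g \in G /\ forall x, c (g x) = c x) (g \in orbker N).
Proof.
have [cN _ _] := Hc; rewrite inE; apply: (iffP andP) => -[gG H]; split=> //.
  move=> x; have /astabP/(_ (orbit 'P N x)) := H.
  move/(_ (imset_f _ (in_setT x)))/setP/(_ (g x)).
  rewrite /= /setact mem_imset ?orbit_refl; last exact: act_inj.
  by rewrite cN => /esym/eqP.
apply/astabP => _ /imsetP[x _ ->]; apply/setP=> y.
rewrite -[y](permKV g) /= /setact mem_imset; last exact: act_inj.
by rewrite !cN H.
Qed.

(** Around a vertex whose value is kept there are only two adjacent fibres, and [g] respects fibres;
    keeping one of them forces keeping the other. Connectedness spreads this. *)
Lemma coord_rigid g x y : g \in G -> adj x y -> c (g x) = c x ->
  c (g y) = c y -> forall z, c (g z) = c z.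
Proof.
move=> gG xy gx gy.
have nb u v w : adj u v -> c (g u) = c u -> c (g v) = c v -> adj u w ->
    c (g w) = c w.
  move=> uv gu gv uw; have [cwv|cwv] := eqVneq (c w) (c v).
    by rewrite cwv -gv; apply: coord_eq.
  have [e cv] := coord_step Hc uv.
  have guv : adj (g u) (g v) by rewrite (og_aut HP).
  have guw : adj (g u) (g w) by rewrite (og_aut HP).
  have cgv : c (g v) = c (g u) + sg e by rewrite gu gv.
  have ncgw : c (g w) <> c (g v) by apply/eqP; rewrite coord_grp.
  by rewrite (coord_two Hc guv guw cgv ncgw) gu (coord_two Hc uv uw cv (elimN
    eqP cwv)).
(* The induction also carries a neighbour whose value is kept, since the local argument starts from
   an edge. *)
pose S z := c (g z) = c z /\ exists2 w, adj z w & c (g w) = c w.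
suff H z : S z by move=> z; case: (H z).
apply: (conn_ind HP (S := S) (x := x)); first by split; [exact: gx | exists y].
move=> u v [gu [w uw gw]] uv; split; first exact: nb uw gu gw uv.
by exists u; rewrite // (og_sym HP).
Qed.

(** This allows a base vertex to be placed at 0 and the cycle to be counted in either sense. *)
Lemma coord_affine e a : is_coord N (fun x => sg e * (c x - a)).
Proof.
have sgu : sg e \is a @GRing.unit 'Z_r by rewrite unitrX ?unitrN ?unitr1.
have [cN cadj cS] := Hc; split.
- by move=> x y; rewrite cN (inj_eq (mulrI sgu)) (inj_eq (addIr _)).
- move=> x y /cadj[e' ->]; exists (e (+) e').
  by rewrite -sg_mul -mulrDr addrAC.
- move=> x e'; have [y xy cy] := cS x (e (+) e'); exists y => //.
  by rewrite cy -addrA addrCA addrC mulrDr sg_mul addbA addbb addrC.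
Qed.

(** If some vertex has two [d]-neighbours in one fibre, transitivity gives this at every vertex, so
    following [d] is a map on fibres. This map cannot turn back, hence it goes round the cycle with
    a constant step. *)
Lemma dir_dichotomy d :
  (exists e, forall x y, darc d x y -> c y = c x + sg e) \/
  (forall x y z, darc d x y -> darc d x z -> c y = c z -> y = z).
Proof.
case: (boolP [exists x, exists y, exists z,
   [&& darc d x y, darc d x z, c y == c z & y != z]]); last first.
  move=> nex; right => x y z xy xz cyz; apply/eqP; apply: contraNT nex => yz.
  apply/existsP; exists x; apply/existsP; exists y; apply/existsP; exists z.
  by rewrite xy xz cyz eqxx.
case/existsP=> x0 /existsP[y0 /existsP[z0 /and4P[xy0 xz0 /eqP cyz0 yz0]]]; left.
have same x y z : darc d x y -> darc d x z -> c y = c z.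
  have [g gG gx] := vert_trans HP x0 x.
  have gy : darc d x (g y0) by rewrite -gx darc_grp.
  have gz : darc d x (g z0) by rewrite -gx darc_grp.
  have ngyz : g y0 != g z0 by rewrite (inj_eq perm_inj).
  have cgyz : c (g y0) = c (g z0) by apply: coord_eq.
  have [y1 [z1 [_ _ _ only2]]] := dir_two HP d x.
  case: (only2 _ gy) (only2 _ gz) ngyz cgyz => -> [] ->; rewrite ?eqxx // => _ e1.
    by case/only2=> ->; case/only2=> ->.
  by case/only2=> ->; case/only2=> ->.
(* An element of [N] carries [x] to [x'] and keeps the value at [y], so the fibre reached depends
   only on the fibre left. *)
have same_cl x x' y y' : c x = c x' -> darc d x y -> darc d x' y' -> c y = c y'.
  case/coord_fib=> n nN nx xy xy'; rewrite -(coord_fix y nN).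
  by apply: same xy'; rewrite -nx darc_grp // (subsetP (normal_sub nNG)).
(* If one [d]-path of length two returned to its fibre, arc-transitivity would make all of them
   return. The neighbour [w] of [x] on the side opposite to [y] then contradicts this, whichever way
   the edge between [x] and [w] points. *)
have nret x y z : darc d x y -> darc d y z -> c z <> c x.
  move=> xy yz czx.
  have ret x' y' z' : darc d x' y' -> darc d y' z' -> c z' = c x'.
    move=> xy' yz'; have [g gG [gx gy]] := arc_trans HP xy xy'.
    rewrite -gx -(coord_eq gG czx); apply: same yz' _.
    by rewrite -gy darc_grp.
  have [e cy] := coord_step Hc (darc_adj HP xy).
  have [_ _ /(_ x (~~ e))[w xw cw]] := Hc.
  have [dxw|dxw] := boolP (darc d x w).
    have := same _ _ _ dxw xy; rewrite cw cy => /(sg_neq r3).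
    by case: (e).
  have dwx : darc d w x by rewrite -darcN darc_adjE.
  have := ret _ _ _ dwx xy; rewrite cw cy => /(sg_neq r3).
  by case: (e).
have [e cy0] := coord_step Hc (darc_adj HP xy0).
exists e => x; apply: (conn_ind HP (S := fun x => forall y,
  darc d x y -> c y = c x + sg e) (x := x0)) x.
  by move=> y xy; rewrite -cy0; apply: same xy xy0.
move=> x w Sx xw z wz.
have [y [_ [_ xy _ _]]] := dir_two HP d x.
have [dxw|dxw] := boolP (darc d x w).
  have wx : adj w x by rewrite (og_sym HP).
  have cx : c x = c w + sg (~~ e) by apply: sgK; apply: Sx.
  by rewrite (coord_two Hc wx (darc_adj HP wz) cx (nret _ _ _ dxw wz)) negbK.
have dwx : darc d w x by rewrite -darcN darc_adjE.
rewrite (same _ _ _ wz dwx).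
have cwy : c w <> c y by move=> cwy; apply: (nret _ _ _ dwx xy); rewrite cwy.
by rewrite (sgK (coord_two Hc (darc_adj HP xy) xw (Sx _ xy) cwy)) negbK.
Qed.

(** A constant step along reversed arcs is a constant step along arcs, so outside the oriented case
    both directions separate neighbours by their values. *)
Lemma coord_dichotomy : oriented c \/ unoriented c.
Proof.
have [[e o]|u1] := dir_dichotomy true; first by left; exists e.
have [[e o]|u2] := dir_dichotomy false.
  by left; exists (~~ e) => x y xy; apply: sgK; apply: o.
right => x d e.
have u y z : darc d x y -> darc d x z -> c y = c z -> y = z by case: (d);
  [apply: u1|apply: u2].
have [y [z [yz xy xz _]]] := dir_two HP d x.
have [e' cy] := coord_step Hc (darc_adj HP xy).
have ncyz : c z <> c y by move=> h; case/eqP: yz; apply: u.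
have cz := coord_two Hc (darc_adj HP xy) (darc_adj HP xz) cy ncyz.
have [ee|ee] := eqVneq e' e.
  by exists y; split; rewrite ?cy ?ee // => y' xy' cy'; apply: u;
    rewrite // cy' -ee -cy.
exists z; split; rewrite ?cz //; first by case: e e' ee {cy cz} => [] [].
by move=> y' xy' cy'; apply: u; rewrite // cy' -cz.
Qed.

End OneCoordinate.

(** * Orientation of a coordinate and of its normal quotient *)

Section Orientation.
Local Open Scope ring_scope.
Variables (P : gpair) (N : {set {perm P}}) (r : nat) (c : P -> 'Z_r).
Hypotheses (HP : OG4 P) (r3 : (3 <= r)%N) (Hc : is_coord N c).

Lemma coord_qvert (B : qvert N) x y :
  x \in val B -> y \in val B -> c x = c y.
Proof.
have [cN _ _] := Hc.
by case/imsetP: (valP B) => z _ ->; rewrite !cN => /eqP <- /eqP.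
Qed.

Lemma oriented_dir e d x y : (forall x y, darc true x y -> c y = c x + sg e) ->
  darc d x y -> c y = c x + sg (e (+) ~~ d).
Proof.
move=> o; case: d => [/o->|/= /o/sgK->]; first by rewrite addbF.
by rewrite addbT.
Qed.

Lemma unoriented_inj d x y y' : unoriented c ->
  darc d x y -> darc d x y' -> c y = c y' -> y = y'.
Proof.
move=> u xy xy' cy; have [_ cadj _] := Hc.
have [e cye] := cadj _ _ (darc_adj HP xy).
have [z [_ cz uz]] := u x d e.
have cyz : c y = c z by rewrite cye cz.
have cyz' : c y' = c z by rewrite -cy.
by rewrite (uz y xy cyz) (uz y' xy' cyz').
Qed.

(** Two edges between the same fibres with opposite directions would make the two signs equal. *)
Lemma oriented_G_oriented : oriented c -> G_oriented N.
Proof.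
move=> [e o] B C /andP[_ /existsP[x /andP[xB /existsP[y /andP[yC xy]]]]].
have [d dxy] := adj_darc HP xy.
have key u v : u \in val B -> v \in val C -> adj u v -> darc d u v.
  move=> uB vC uv; case: (boolP (darc d u v)) => // nd.
  have dvu : darc d v u by rewrite -darcN darc_adjE.
  case: d dxy dvu {nd} => /= /o h1 /o h2; exfalso.
    have := sgK h2; rewrite (coord_qvert vC yC) h1 (coord_qvert uB xB).
    by move/(sg_neq r3); case: (e).
  have := sgK h1; rewrite (coord_qvert yC vC) h2 (coord_qvert uB xB).
  by move/(sg_neq r3); case: (e).
by case: d key {dxy} => key; [left | right].
Qed.

(** At any vertex [x] an out-neighbour and an in-neighbour both have value [c x + 1], so they lie in
    one orbit and the edges to them point in opposite ways. *)
Lemma unoriented_not_G_oriented (x : P) : unoriented c -> ~ G_oriented N.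
Proof.
move=> u; have [cN _ _] := Hc.
have [y [xy cy _]] := u x true false; have [z [xz cz _]] := u x false false.
have xx : x \in val (orb_vert N x) by rewrite cN.
have yy : y \in val (orb_vert N y) by rewrite cN.
have zy : z \in val (orb_vert N y) by rewrite cN cy cz.
have q : qadj (orb_vert N x) (orb_vert N y).
  apply/andP; split; last first.
    apply/existsP; exists x; rewrite xx; apply/existsP; exists y.
    by rewrite yy (darc_adj HP xy).
  apply/eqP => BC; rewrite BC in xx; have := coord_qvert xx yy.
  rewrite cy -[LHS]addr0 => /addrI/esym/eqP.
  by rewrite (negPf (sg_neq0 _ _)).
case/(_ _ _ q) => H.
  by have := H x z xx zy (darc_adj HP xz); apply/negP; apply: (darcNC HP xz).
by have := H x y xx yy (darc_adj HP xy); apply/negP; apply: (darcNC HP xy).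
Qed.

End Orientation.

(** * Independence *)

Section Reduction.
Local Open Scope ring_scope.
Variables k r : nat.
Hypotheses (k1 : (1 < k)%N) (r1 : (1 < r)%N) (rk : (r %| k)%N).

Definition Zp_red (i : 'Z_k) : 'Z_r := (i : nat)%:R.

Lemma Zp_redD i j : Zp_red (i + j) = Zp_red i + Zp_red j.
Proof.
rewrite /Zp_red -natrD; apply: val_inj; rewrite /= !val_Zp_nat //.
by rewrite modn_dvdm // Zp_cast.
Qed.

Lemma Zp_red0 : Zp_red 0 = 0.
Proof. by []. Qed.

Lemma Zp_red_sg e : Zp_red (sg e) = sg e.
Proof.
have red1 : Zp_red 1 = 1 by [].
case: e; rewrite /sg ?expr1 ?expr0 //.
by apply/eqP; rewrite -addr_eq0 -[X in _ + X]red1 -Zp_redD addNr.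
Qed.

End Reduction.

(** The uniqueness half of the Chinese remainder theorem: the difference of the representatives is
    divisible by r and by s, hence by their lcm. *)
Lemma Zp_red_inj r s (i j : 'Z_(lcmn r s)) :
  1 < r -> 1 < s ->
  Zp_red r i = Zp_red r j -> Zp_red s i = Zp_red s j -> i = j.
Proof.
move=> r1 s1 hr hs.
have k0 : 0 < lcmn r s by rewrite lcmn_gt0 (ltnW r1) (ltnW s1).
have k1 : 1 < lcmn r s by rewrite (leq_trans r1) // dvdn_leq // dvdn_lcml.
move/(congr1 (@nat_of_ord _)): hr; move/(congr1 (@nat_of_ord _)): hs.
rewrite !val_Zp_nat // => hs hr; apply: val_inj => /=.
have ltk (l : 'Z_(lcmn r s)) : l < lcmn r s by rewrite -[X in _ < X]Zp_cast.
rewrite -(modn_small (ltk i)) -(modn_small (ltk j)).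
move: (i : nat) (j : nat) hs hr {ltk} => {i j}.
move=> i j; wlog ij : i j / i <= j.
  move=> H hs hr; case/orP: (leq_total i j) => [/H->|/H ->] //; exact/esym.
move=> hs hr; apply/esym/eqP; rewrite eqn_mod_dvd // dvdn_lcm -!eqn_mod_dvd //.
by rewrite hs hr !eqxx.
Qed.

Section TwoCoordinates.
Local Open Scope ring_scope.
Variables (P : gpair) (N M : {group {perm P}}) (r s : nat).
Hypotheses (HP : OG4 P) (r3 : (3 <= r)%N) (s3 : (3 <= s)%N).
Hypotheses (nNG : N <| grp P) (nMG : M <| grp P).
Local Notation G := (grp P).
Local Notation K := (orbker N :&: orbker M).

Lemma lcm_ge3 : (3 <= lcmn r s)%N.
Proof.
apply: leq_trans r3 (dvdn_leq _ (dvdn_lcml r s)).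
by rewrite lcmn_gt0 (ltnW (ltnW r3)) (ltnW (ltnW s3)).
Qed.

(** Starting from (0, 0) the two coordinates are reductions of one coordinate modulo the lcm. Its
    fibres are the [K]-orbits: an element of [N] joining two vertices of a fibre keeps [c1], hence
    keeps [c2] on an edge, hence everywhere by [coord_rigid]. *)
Lemma diagonal_cycle (c1 : P -> 'Z_r) (c2 : P -> 'Z_s) (x0 : P) :
  is_coord N c1 -> is_coord M c2 -> c1 x0 = 0 -> c2 x0 = 0 ->
  (forall x y e, adj x y -> c1 y = c1 x + sg e -> c2 y = c2 x + sg e) ->
  quotient_cycle K (lcmn r s).
Proof.
move=> Hc1 Hc2 z1 z2 diag.
have r1 := ltnW r3; have s1 := ltnW s3.
have kr : (r %| lcmn r s)%N := dvdn_lcml r s.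
have ks : (s %| lcmn r s)%N := dvdn_lcmr r s.
have k1 := ltnW lcm_ge3.
pose is_c x (i : 'Z_(lcmn r s)) := (c1 x == Zp_red r i) && (c2 x == Zp_red s i).
have ex_c x : exists i, is_c x i.
  apply: (conn_ind HP (S := fun x => exists i, is_c x i) (x := x0)).
    by exists 0; rewrite /is_c z1 z2 !Zp_red0 !eqxx.
  move=> {}x y [i /andP[/eqP c1x /eqP c2x]] xy.
  have [e c1y] := coord_step Hc1 xy; have c2y := diag _ _ _ xy c1y.
  exists (i + sg e); rewrite /is_c c1y c2y c1x c2x !Zp_redD // !Zp_red_sg //.
  by rewrite !eqxx.
pose c x := xchoose (ex_c x).
have cE x : c1 x = Zp_red r (c x) /\ c2 x = Zp_red s (c x).
  by have /andP[/eqP ? /eqP ?] := xchooseP (ex_c x).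
have c_step x y e : adj x y -> c1 y = c1 x + sg e -> c y = c x + sg e.
  move=> xy c1y; have c2y := diag _ _ _ xy c1y.
  have [c1xE c2xE] := cE x; have [c1yE c2yE] := cE y.
  apply: Zp_red_inj => //; rewrite Zp_redD // Zp_red_sg //.
    by rewrite -c1yE -c1xE.
  by rewrite -c2yE -c2xE.
apply: (coord_cycle (c := c)) => //; first exact: lcm_ge3.
split.
- move=> x y; apply/idP/eqP.
    case/orbitP=> g /setIP[/(orbkerP Hc1)[gG g1] /(orbkerP Hc2)[_ g2]] <-.
    have [c1xE c2xE] := cE x; have [c1yE c2yE] := cE (g x).
    by apply: Zp_red_inj => //; [rewrite -c1yE g1 | rewrite -c2yE g2].
  move=> cxy; have [[c1xE c2xE] [c1yE c2yE]] := (cE x, cE y).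
  have c1xy : c1 x = c1 y by rewrite c1xE cxy.
  have c2xy : c2 x = c2 y by rewrite c2xE cxy.
  have [g gN gx] := coord_fib Hc1 c1xy.
  have gG := subsetP (normal_sub nNG) _ gN.
  have g1 z : c1 (g z) = c1 z := coord_fix Hc1 z gN.
  have [_ _ /(_ x false)[w xw c1w]] := Hc1.
  have g2 : forall z, c2 (g z) = c2 z.
    apply: (coord_rigid HP nMG Hc2 gG xw); first by rewrite gx.
    rewrite (diag _ _ _ xw c1w) c2xy -gx; apply: diag; last by rewrite !g1.
    by rewrite (og_aut HP).
  rewrite -gx; apply: mem_orbit; rewrite inE.
  by apply/andP; split; [apply/(orbkerP Hc1) | apply/(orbkerP Hc2)].
- by move=> x y xy; have [e /(c_step _ _ _ xy)] := coord_step Hc1 xy; exists e.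
- move=> x e; have [_ _ /(_ x e)[y xy /(c_step _ _ _ xy)]] := Hc1; by exists y.
Qed.

Variables (c1 : P -> 'Z_r) (c2 : P -> 'Z_s).
Hypotheses (Hc1 : is_coord N c1) (Hc2 : is_coord M c2).

(** Translation to 0 and reflection of [c2] by the constant sign reduce this to the diagonal
    case. *)
Lemma aligned_cycle (x0 : P) e0 :
  (forall x y a, adj x y -> c1 y = c1 x + sg a -> c2 y = c2 x + sg (a (+) e0)) ->
  quotient_cycle K (lcmn r s).
Proof.
move=> al.
apply: (diagonal_cycle (x0 := x0) (coord_affine Hc1 false (c1 x0))
  (coord_affine Hc2 e0 (c2 x0))).
- by rewrite subrr mulr0.
- by rewrite subrr mulr0.
move=> x y a xy; rewrite {1 2}/sg expr0 !mul1r => h.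
have /(al _ _ _ xy) -> : c1 y = c1 x + sg a.
  by apply: (@addIr _ (- c1 x0)); rewrite h addrAC.
by rewrite addrAC mulrDr sg_mul addbC addbK.
Qed.

Lemma aligned_propagate x y e e' a :
  c1 y = c1 x + sg a -> c2 y = c2 x + sg (a (+) e) ->
  (forall b, c1 x = c1 y + sg b -> c2 x = c2 y + sg (b (+) e')) -> e' = e.
Proof.
move=> h1 h2 /(_ _ (sgK h1)); rewrite (sgK h2) => /(sg_neq s3).
by case: a e e' {h1 h2} => [] [] [].
Qed.

Hypothesis indep : independent N M.

(** Otherwise transitivity produces two such neighbours at every vertex, and the orientation cases
    leave only a sign relation between the coordinates, against independence. *)
Lemma independent_loc x y y' :
  adj x y -> adj x y' -> c1 y = c1 y' -> c2 y = c2 y' -> y = y'.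
Proof.
move=> xy xy' c1y c2y; apply/eqP; case: eqVneq => // ne; exfalso; apply: indep.
exists (lcmn r s); first exact: lcm_ge3.
pose A u e := forall v a, adj u v -> c1 v = c1 u + sg a ->
  c2 v = c2 u + sg (a (+) e).
suff [e Ae] : exists e, forall u,
  A u e by apply: (aligned_cycle x (e0 := e)) => *; apply: Ae.
(* A relation with a sign depending on the vertex suffices, because the signs at the two ends of an
   edge agree. *)
suff locA u : exists e, A u e.
  have [e Ae] := locA x; exists e; apply: (conn_ind HP (S := fun u => A u e) Ae).
  move=> u v Au uv; have [e' Av] := locA v.
  have [a c1v] := coord_step Hc1 uv.
  rewrite -(aligned_propagate (e' := e') c1v (Au _ _ uv c1v)) // => b.
  by apply: Av; rewrite (og_sym HP).
have [v [v' [uv uv' c1v c2v nev]]] :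
    exists v v', [/\ adj u v, adj u v', c1 v = c1 v', c2 v = c2 v' & v <> v'].
  have [g gG gx] := vert_trans HP x u; exists (g y), (g y').
  rewrite -gx !(og_aut HP) //; split=> //.
  - exact: (coord_eq nNG Hc1 gG c1y).
  - exact: (coord_eq nMG Hc2 gG c2y).
  - by move/perm_inj/eqP; apply/negP.
have [d dv] := adj_darc HP uv; have [d' dv'] := adj_darc HP uv'.
(* If both coordinates are oriented, the relation is immediate. If exactly one is, it gives [v] and
   [v'] the same direction, and the other one then identifies them. *)
have [[e1 o1]|u1] := coord_dichotomy HP r3 nNG Hc1;
have [[e2 o2]|u2] := coord_dichotomy HP s3 nMG Hc2.
- exists (e1 (+) e2) => w a uw; have [dw dirw] := adj_darc HP uw.
  rewrite (oriented_dir o1 dirw) (oriented_dir o2 dirw) => /(sg_neq r3) <-.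
  by congr (_ + sg _); case: dw e1 e2 {o1 o2 dirw} => [] [] [].
- case: nev; suff dd : d' = d by rewrite dd in dv';
  exact: (unoriented_inj HP Hc2 u2 dv dv').
  move: c1v; rewrite (oriented_dir o1 dv) (oriented_dir o1 dv') => /(sg_neq r3).
  by case: d d' e1 {o1 dv dv'} => [] [] [].
- case: nev; suff dd : d' = d by rewrite dd in dv';
  exact: (unoriented_inj HP Hc1 u1 dv dv').
  move: c2v; rewrite (oriented_dir o2 dv) (oriented_dir o2 dv') => /(sg_neq s3).
  by case: d d' e2 {o2 dv dv'} => [] [] [].
have [a c1a] := coord_step Hc1 uv; have [b c2b] := coord_step Hc2 uv.
exists (a (+) b) => w a' uw c1w; have [dw dirw] := adj_darc HP uw.
(* With both coordinates unoriented, [v] and [v'] have opposite directions, so one of them, [z], has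
   the direction of [w]. Then [w] agrees with [z] in both coordinates or differs from it in both. *)
have [z [dz c1z c2z]] : exists z, [/\ darc dw u z, c1 z = c1 v & c2 z = c2 v].
  have [dd|dd] := eqVneq dw d; first by exists v; rewrite dd.
  exists v'; split=> //; have [d'd|d'd] := eqVneq d' d.
    by rewrite d'd in dv'; case: nev; exact: (unoriented_inj HP Hc1 u1 dv dv').
  by case: d d' dw dd d'd dv' {dv dirw} => [] [] [].
have [cwz|cwz] := eqVneq (c1 w) (c1 z).
  rewrite (unoriented_inj HP Hc1 u1 dirw dz cwz) c2z c2b; congr (_ + sg _).
  move: c1w; rewrite cwz c1z c1a => /(sg_neq r3) <-.
  by rewrite addbA addbb.
have c1w' : c1 w = c1 u + sg (~~ a).
  by apply: (coord_two Hc1 uv uw c1a); apply/eqP; rewrite -c1z.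
have -> : c2 w = c2 u + sg (~~ b).
  apply: (coord_two Hc2 uv uw c2b) => c2w; case/eqP: cwz; congr c1.
  by apply: (unoriented_inj HP Hc2 u2 dirw dz); rewrite c2w.
move: c1w; rewrite c1w' => /(sg_neq r3) <-; congr (_ + sg _).
by case: a b {c1a c2b c1w'} => [] [].
Qed.

End TwoCoordinates.

(** * Rigidity *)

Section ArcPart.
Variables (P : gpair) (T : eqType) (c : P -> T).

(** A common ambient group for the induced group and the model group. Only the partition into fibres
    is preserved, not the values, since group elements may rotate or reflect the cycle. *)
Definition arc_part : {set {perm P}} :=
  [set h : {perm P} | [forall x, forall y,
     (((h x, h y) \in arcs P) == ((x, y) \in arcs P)) &&
     ((c (h x) == c (h y)) == (c x == c y))]].

Lemma arc_partP (h : {perm P}) :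
  reflect ((forall d x y, darc d (h x) (h y) = darc d x y) /\
           (forall x y, (c (h x) == c (h y)) = (c x == c y)))
          (h \in arc_part).
Proof.
rewrite inE; apply: (iffP idP) => [/forallP H|[h1 h2]].
  have H2 x y := andP (forallP (H x) y).
  split=> [d x y|x y]; last by have [_ /eqP] := H2 x y.
  by case: d; [have [/eqP ? _] := H2 x y | have [/eqP ? _] := H2 y x].
apply/forallP=> x; apply/forallP=> y; rewrite h2 eqxx andbT.
by apply/eqP; exact: (h1 true).
Qed.

Lemma arc_part_group_set : group_set arc_part.
Proof.
apply/group_setP; split=> [|g h /arc_partP[g1 g2] /arc_partP[h1 h2]].
  by apply/arc_partP; split=> *; rewrite !perm1.
by apply/arc_partP; split=> *; rewrite !permM ?h1 ?h2.
Qed.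

Canonical arc_part_group := Group arc_part_group_set.

End ArcPart.

Definition arc_transitive (P : gpair) (H : {set {perm P}}) :=
  forall x y x' y', darc true x y -> darc true x' y' ->
  exists2 h : {perm P}, h \in H & h x = x' /\ h y = y'.

Section Rigidity.
Local Open Scope ring_scope.
Variables (P : gpair) (N : {set {perm P}}) (r : nat) (c : P -> 'Z_r).
Hypotheses (HP : OG4 P) (r3 : (3 <= r)%N) (Hc : is_coord N c).
Hypothesis u : unoriented c.

(** Next to a fixed edge, a neighbour and its image have the same direction and the same value, so
    they coincide because [c] is unoriented; connectedness does the rest. *)
Lemma arc_part_rigid (h : {perm P}) x y :
  h \in arc_part c -> adj x y -> h x = x -> h y = y -> h = 1%g.
Proof.
move=> /arc_partP[hd hc] xy hx hy.
have nb v w w' : adj v w -> h v = v -> h w = w -> adj v w' -> h w' = w'.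
  move=> vw hv hw vw'; have [d dw'] := adj_darc HP vw'.
  have dhw : darc d v (h w') by rewrite -{1}hv hd.
  apply: (unoriented_inj HP Hc u dhw dw').
  have [cw|cw] := eqVneq (c w') (c w).
    by have := hc w' w; rewrite hw cw eqxx => /eqP.
  have ncw : c (h w') <> c w by apply/eqP; rewrite -{1}hw hc.
  have [e cwe] := coord_step Hc vw.
  rewrite (coord_two Hc vw vw' cwe (elimN eqP cw)).
  by apply: (coord_two Hc vw _ cwe ncw); apply: darc_adj dhw.
pose S z := h z = z /\ exists2 w, adj z w & h w = w.
suff H z : S z by apply/permP => z; rewrite perm1; case: (H z).
apply: (conn_ind HP (S := S) (x := x)); first by split=> //; exists y.
move=> v w [hv [w' vw' hw']] vw; split; first exact: nb vw' hv hw' vw.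
by exists v; rewrite // (og_sym HP).
Qed.

(** For [h] in [A] some [k] in [B] has the same effect on one arc, and [h * k^-1] is trivial by
    rigidity. *)
Lemma arc_part_sub (A B : {group {perm P}}) :
  A \subset arc_part c -> B \subset arc_part c -> arc_transitive B -> P ->
  A \subset B.
Proof.
move=> sA sB tB x; apply/subsetP=> h hA.
have [y [_ [_ xy _ _]]] := dir_two HP true x.
have /arc_partP[hd _] := subsetP sA _ hA.
have hxy : darc true (h x) (h y) by rewrite hd.
have [k kB [kx ky]] := tB _ _ _ _ xy hxy.
suff -> : h = k by [].
apply/eqP; rewrite eq_mulgV1; apply/eqP; apply: (arc_part_rigid (x := x) (y := y)).
- by apply: groupM; [apply: (subsetP sA) | rewrite groupV; apply: (subsetP sB)].
- exact: darc_adj xy.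
- by rewrite permM -kx permK.
- by rewrite permM -ky permK.
Qed.

End Rigidity.

(** * The vertex stabiliser *)

Section Stabiliser.
Variables (P : gpair) (N : {group {perm P}}) (r : nat) (c : P -> 'Z_r).
Hypotheses (HP : OG4 P) (r3 : 3 <= r) (nNG : N <| grp P) (Hc : is_coord N c).
Local Notation G := (grp P).

Lemma grp_arc_part : G \subset arc_part c.
Proof.
apply/subsetP=> g gG; apply/arc_partP; split=> *; first by rewrite (darc_grp HP).
by rewrite (coord_grp nNG Hc).
Qed.

(** An element fixing [x] is determined by the out-neighbour to which it sends [y]; both choices
    occur by arc-transitivity. *)
Lemma stab_Zp2 (x : P) : unoriented c -> 'C_G[x | 'P] \isog Zp 2.
Proof.
move=> u; have [y [z [yz xy xz xyz]]] := dir_two HP true x.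
have [t tG [tx ty]] := arc_trans HP xy xz.
have memC (g : {perm P}) : (g \in 'C_G[x | 'P]) = (g \in G) && (g x == x).
  by rewrite inE; congr andb; apply/astab1P/eqP.
have C2 : 'C_G[x | 'P] = [set 1; t].
  apply/setP=> g; rewrite memC in_set2; apply/andP/orP.
    case=> gG /eqP gx; have : darc true x (g y) by rewrite -{1}gx darc_grp.
    have gA := subsetP grp_arc_part _ gG.
    have tA := subsetP grp_arc_part _ tG.
    case/xyz=> [gy|gz]; [left | right].
      by rewrite (arc_part_rigid HP Hc u gA (darc_adj HP xy) gx gy).
    rewrite eq_mulgV1; apply/eqP.
    apply: (arc_part_rigid HP Hc u (x := x) (y := y)).
    - by rewrite groupM ?groupV.
    - exact: darc_adj xy.
    - by rewrite permM gx -{1}tx permK.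
    - by rewrite permM gz -ty permK.
  by case=> /eqP->; rewrite ?group1 ?perm1 ?tG ?tx.
have t1 : 1 != t by apply: contraNneq yz => t1; rewrite -ty -t1 perm1.
have card2 : #|'C_G[x | 'P]| = 2 by rewrite C2 cards2 t1.
rewrite isog_cyclic_card; last by apply: prime_cyclic; rewrite card2.
by rewrite prime_cyclic card_Zp // card2.
Qed.

End Stabiliser.

(** * Identifying a quotient with a model *)

Definition orbker_group (P : gpair) (N : {set {perm P}}) : {group {perm P}} :=
  'C_(grp P)(orbs N | 'P^*)%G.

Lemma first_isom_ker (aT rT : finGroupType) (G K : {group aT})
    (f : {morphism G >-> rT}) : 'ker f = K ->
  exists phi : {morphism G / K >-> rT},
    isom (G / K) (f @* G) phi /\ forall g, g \in G -> phi (coset K g) = f g.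
Proof.
move=> kerK; have nKG : G \subset 'N(K) by rewrite -kerK ker_norm.
have skk : 'ker (coset K) \subset 'ker f by rewrite ker_coset kerK.
exists (factm_morphism skk nKG); split; last by move=> g gG; apply: factmE.
apply/isomP; split; first by rewrite ker_factm kerK -quotientE trivg_quotient.
exact: morphim_factm.
Qed.

(** A coordinate for the trivial group is injective, yet the four neighbours of a vertex take at
    most two values. *)
Lemma valency4_not_cycle (L : gpair) (x : L) k :
  OG4 L -> 3 <= k -> ~ quotient_cycle [1 {perm L}] k.
Proof.
move=> HL k3 /(cycle_coord HL k3 (sub1G _)).
have orb1 y z : (z \in orbit 'P [1 {perm L}] y) = (z == y).
  apply/orbitP/eqP => [[g /set1P-> <-]|->]; first exact: perm1.
  by exists 1; rewrite ?group1 // /= /aperm perm1.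
case=> [y z yz|c [cE cS _]].
  by rewrite orb1; apply: contraTneq yz => ->; rewrite (og_irr HL).
have c_inj : injective c by move=> y z /eqP; rewrite -cE orb1 => /eqP.
have := og_valency HL x; rewrite -(card_imset _ c_inj) => c4.
suff : #|c @: [set y | adj x y]| <= 2 by rewrite c4.
apply: leq_trans (_ : #|[set (c x + sg true)%R; (c x + sg false)%R]| <= 2).
  apply: subset_leq_card; apply/subsetP=> _ /imsetP[y + ->].
  by rewrite inE => /cS[[] ->]; rewrite !inE eqxx ?orbT.
by rewrite cards2; case: (_ != _).
Qed.

(** * Descent along a map [f] whose fibres are the [K]-orbits *)

Section Transfer.
Variables (P : gpair) (N M : {group {perm P}}) (r s : nat).
Hypotheses (HP : OG4 P) (r3 : 3 <= r) (s3 : 3 <= s).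
Hypotheses (nNG : N <| grp P) (nMG : M <| grp P).
Local Notation G := (grp P).
Local Notation K := (orbker_group N :&: orbker_group M)%G.
Variables (c1 : P -> 'Z_r) (c2 : P -> 'Z_s).
Hypotheses (Hc1 : is_coord N c1) (Hc2 : is_coord M c2).
Variables (T : finType) (a : rel T) (D : {set T * T}).
Variables (f : P -> T) (d1 : T -> 'Z_r) (d2 : T -> 'Z_s).
Hypotheses (fd1 : forall x, d1 (f x) = c1 x) (fd2 : forall x, d2 (f x) = c2 x).
Hypothesis loc : forall x y y',
  adj x y -> adj x y' -> c1 y = c1 y' -> c2 y = c2 y' -> y = y'.
Hypothesis fadj : forall x y, adj x y -> a (f x) (f y).
Hypothesis flift : forall x v, a (f x) v -> exists2 y, adj x y & f y = v.
Hypothesis farc : forall x y, adj x y -> ((f x, f y) \in D) = ((x, y) \in arcs P).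
Hypothesis Dadj : forall u v, (u, v) \in D -> a u v.
Hypothesis fsurj : forall u, exists x, f x = u.
Hypothesis fK : forall x y, f x = f y <-> y \in orbit 'P K x.
Variable x0 : P.

Lemma fE x y : f x = f y -> c1 x = c1 y /\ c2 x = c2 y.
Proof. by move=> fxy; rewrite -!fd1 -!fd2 fxy. Qed.

Lemma floc x y y' : adj x y -> adj x y' -> f y = f y' -> y = y'.
Proof. by move=> xy xy' /fE[]; apply: loc xy xy'. Qed.

Lemma fadjE x v : a (f x) v -> exists y, [/\ adj x y, f y = v &
  forall d, darc d x y = (if d then (f x, v) \in D else (v, f x) \in D)].
Proof.
case/flift=> y xy fy; exists y; split=> // d.
by case: d; rewrite -fy farc // (og_sym HP).
Qed.

Lemma KP g : reflect [/\ g \in G, forall x, c1 (g x) = c1 x &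
  forall x, c2 (g x) = c2 x] (g \in K).
Proof.
apply: (iffP setIP) => [[/(orbkerP Hc1)[? ?] /(orbkerP Hc2)[_ ?]]|[gG g1 g2]].
  by split.
by split; [apply/(orbkerP Hc1) | apply/(orbkerP Hc2)].
Qed.

Lemma orbker_normal (N' : {group {perm P}}) t (c : P -> 'Z_t) :
  N' <| G -> is_coord N' c -> orbker_group N' <| G.
Proof.
move=> nN Hc; rewrite /normal subsetIl; apply/subsetP=> g gG; rewrite inE.
apply/subsetP=> _ /imsetP[h /(orbkerP Hc)[hG hc] ->].
apply/(orbkerP Hc); split=> [|x]; first by rewrite groupJ.
by rewrite -{2}(permKV g x) !permM; apply: (coord_eq nN Hc gG).
Qed.

Lemma K_normal : K <| G.
Proof. exact: normalI (orbker_normal nNG Hc1) (orbker_normal nMG Hc2). Qed.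

Lemma f_grp g x y : g \in G -> f x = f y -> f (g x) = f (g y).
Proof.
move=> gG /fK/orbitP[k kK <-]; apply/fK/orbitP; exists (k ^ g).
  by rewrite memJ_norm // (subsetP (normal_norm K_normal)).
by rewrite /= /aperm !permM permK.
Qed.

(** The permutation induced by [g] on the fibres of [f]. For [g] in the group it exists because [K]
    is normal, so the default 1 is not reached. *)
Definition theta (g : {perm P}) : {perm T} :=
  odflt 1 [pick p : {perm T} | [forall x, p (f x) == f (g x)]].

Lemma thetaE g x : g \in G -> theta g (f x) = f (g x).
Proof.
move=> gG; rewrite /theta; case: pickP => [p /forallP/(_ x)/eqP //|no].
have [inv invK] := fin_all_exists fsurj.
have h_inj : injective (fun u => f (g (inv u))).
  by move=> u v /(f_grp (groupVr gG)); rewrite !permK !invK.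
have /negP[] := negbT (no (perm h_inj)); apply/forallP => y; rewrite permE.
by apply/eqP/f_grp; rewrite ?invK.
Qed.

Lemma theta_morphM : {in G &, {morph theta : g h / g * h}}.
Proof.
move=> g h gG hG; apply/permP=> u; have [x <-] := fsurj u.
by rewrite permM !thetaE ?groupM // permM.
Qed.

Canonical theta_morphism := Morphism theta_morphM.

(** Acting trivially below means keeping both coordinates, which is membership in [K]; conversely
    [K] preserves every fibre of [f]. *)
Lemma ker_theta : 'ker theta = K.
Proof.
apply/setP=> g; apply/idP/idP.
  case/setIP=> gG; rewrite 2!inE => /eqP th1; apply/KP; split=> // x.
    by rewrite -!fd1 -thetaE // th1 perm1.
  by rewrite -!fd2 -thetaE // th1 perm1.
move=> gK; have [gG _ _] := KP _ gK; apply/kerP=> //; apply/permP=> u.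
have [x <-] := fsurj u; rewrite perm1 /= thetaE //; apply/esym/fK.
exact: mem_orbit.
Qed.

Definition quot_pair : gpair := @GPair T a (theta @* G)%G D.
Local Notation L := quot_pair.

Lemma theta_lift p : p \in theta @* G ->
  exists2 g, g \in G & forall x, p (f x) = f (g x).
Proof. by case/morphimP=> g gG _ ->; exists g => // x; apply: thetaE. Qed.

Lemma lift_theta g : g \in G ->
  exists2 p, p \in theta @* G & forall x, p (f x) = f (g x).
Proof.
by move=> gG; exists (theta g); [apply: mem_morphim | move=> x; apply: thetaE].
Qed.

(** By [flift] and [floc] the map [f] is bijective on neighbourhoods, so valency and connectedness
    descend, and transitivity descends through [theta]. *)
Lemma quot_OG4 : OG4 L.
Proof.
have adjS u v : a u v -> a v u.
  have [x <-] := fsurj u => /flift[y xy <-]; apply: fadj.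
  by rewrite (og_sym HP).
have adj_grp p u v : p \in theta @* G -> a u v -> a (p u) (p v).
  case/theta_lift=> g gG pE; have [x <-] := fsurj u => /flift[y xy <-].
  by rewrite !pE; apply: fadj; rewrite (og_aut HP).
have conn x y : connect a (f x) (f y).
  apply: (conn_ind HP (S := fun y => connect a (f x) (f y)) (x := x)) => //.
  by move=> z w /connect_trans zw zw';  apply: zw; apply: connect1; exact: fadj.
have [y0 [_ [_ xy0 _ _]]] := dir_two HP true x0.
(* An edge below lifts to an edge above, which is the image of the base arc up to reversal. *)
have arc_tr u v : a u v -> exists2 p, p \in theta @* G &
    (p (f x0) = u /\ p (f y0) = v) \/ (p (f x0) = v /\ p (f y0) = u).
  have [x <-] := fsurj u => /flift[y xy <-]; have [d dxy] := adj_darc HP xy.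
  case: d dxy => dxy.
    have [g gG [gx gy]] := arc_trans HP xy0 dxy.
    have [p pG pE] := lift_theta gG; exists p => //; left.
    by rewrite !pE gx gy.
  have [g gG [gx gy]] := arc_trans HP xy0 (dxy : darc true y x).
  have [p pG pE] := lift_theta gG; exists p => //; right.
  by rewrite !pE gx gy.
split.
- by move=> u v; apply/idP/idP; apply: adjS.
- move=> u; apply/negP; have [x <-] := fsurj u => /flift[y xy /fE[c1y _]].
  have [e] := coord_step Hc1 xy; rewrite c1y -[LHS]addr0 => /addrI/esym/eqP.
  by rewrite (negPf (sg_neq0 _ _)).
- by move=> u v; have [x <-] := fsurj u; have [y <-] := fsurj v.
- move=> u; have [x <-] := fsurj u; rewrite -(og_valency HP x).
  have -> : [set v | a (f x) v] = f @: [set y | adj x y].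
    apply/setP=> v; rewrite inE; apply/idP/imsetP.
      by case/flift=> y xy <-; exists y; rewrite ?inE.
    by case=> y; rewrite inE => xy ->; apply: fadj.
  by apply: card_in_imset => y z; rewrite !inE; apply: floc.
- move=> p pG u v; apply/idP/idP; last exact: adj_grp.
  by move/(adj_grp _ _ _ (groupVr pG)); rewrite !permK.
- apply/imsetP; exists (f x0); first by rewrite inE.
  apply/esym/setP=> u; rewrite inE; have [x <-] := fsurj u.
  have [g gG <-] := vert_trans HP x0 x; have [p pG pE] := lift_theta gG.
  by apply/orbitP; exists p; rewrite // /= /aperm pE.
- apply/imsetP; exists [set f x0; f y0].
    apply/imsetP; exists (f x0, f y0) => //; rewrite inE /=.
    by apply: fadj; apply: darc_adj xy0.
  apply/setP=> E; apply/imsetP/orbitP.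
    case=> -[u v]; rewrite inE /= => /arc_tr[p pG H] ->; exists p => //.
    rewrite /= /setact imsetU1 imset_set1 /= /aperm /=.
    by case: H => -[-> ->] //; rewrite setUC.
  case=> p pG <-; exists (p (f x0), p (f y0)).
    by rewrite inE /=; apply: adj_grp => //; apply: fadj; apply: darc_adj xy0.
  by rewrite /= /setact imsetU1 imset_set1 /= /aperm.
- exists (f x0), (f y0); apply/setP=> -[u v]; apply/idP/imsetP.
    move=> uvD; have := Dadj uvD; have [x xu] := fsurj u; rewrite -xu.
    case/fadjE=> y [xy yv /(_ true)/=]; rewrite xu uvD => dxy.
    have [g gG [gx gy]] := arc_trans HP xy0 (dxy : darc true x y).
    by have [p pG pE] := lift_theta gG; exists p => //; rewrite !pE gx gy yv xu.
  case=> p pG [-> ->]; have [g gG pE] := theta_lift pG.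
  rewrite !pE farc; first by have := darc_grp HP true x0 y0 gG; rewrite /= => ->.
  by rewrite (og_aut HP) //; apply: darc_adj xy0.
- exact: Dadj.
- move=> u v; have [x <-] := fsurj u => /fadjE[y [xy yv dE]].
  have /= <- := dE true; have /= <- := dE false; exact: og_arcs_one HP _ _ xy.
Qed.

(** The covering kernel is [K]: [flift] gives a neighbour in each adjacent orbit and [floc] makes it
    unique. *)
Lemma quot_normal_cover : normal_cover P L.
Proof.
have repP (B : qvert K) x : x \in val B -> forall y, (y \in val B) <-> f y = f x.
  case/imsetP: (valP B) => z _ -> xz y; split=> [yz|/esym/fK yx].
    by have /fK <- := yz; have /fK <- := xz.
  exact: orbit_trans yx xz.
have inh (B : qvert K) : exists x, x \in val B.
  by case/imsetP: (valP B) => z _ ->; exists z; apply: orbit_refl.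
pose F (B : qvert K) : L := f (odflt x0 [pick x in val B]).
have FE (B : qvert K) x : x \in val B -> F B = f x.
  move=> xB; rewrite /F; case: pickP => [y yB|/(_ x)]; last by rewrite xB.
  by apply/(repP _ _ xB).
have FP (B : qvert K) y : F B = f y -> y \in val B.
  by have [x xB] := inh B; rewrite (FE _ _ xB) => /esym/(repP _ _ xB).
exists K; split; first exact: K_normal.
  move=> B C /andP[_ /existsP[x' /andP[xB' /existsP[y' /andP[yC' xy']]]]] x xB.
  have := fadj xy'; have /(repP _ _ xB') <- := xB; case/flift=> y xy fy.
  have yC : y \in val C by apply/(repP _ _ yC').
  apply/eqP/cards1P; exists y; apply/setP=> z; rewrite !inE.
  apply/andP/eqP => [[zC xz]|->]; last by [].
  by apply: (floc xz xy); apply/(repP _ _ yC).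
have [phi [iso phiE]] := first_isom_ker ker_theta.
exists F, phi; split.
- have F_inj : injective F.
    move=> B C eqF; apply: val_inj; apply/setP=> y; have [x xB] := inh B.
    have xC : x \in val C by apply: FP; rewrite -eqF; apply: FE.
    by apply/idP/idP=> [/(repP _ _ xB)|/(repP _ _ xC)] h;
      [apply/(repP _ _ xC)|apply/(repP _ _ xB)].
  apply: inj_card_bij => //; rewrite -(card_codom (f := F)) //.
  apply: subset_leq_card; apply/subsetP=> u _; have [x <-] := fsurj u.
  apply/codomP; exists (orb_vert K x); apply/esym/FE; exact: orbit_refl.
- move=> B C; apply/idP/idP.
    have [x xB] := inh B; rewrite (FE _ _ xB) => /flift[y xy /esym fy].
    have yC := FP _ _ fy; apply/andP; split.
      apply/eqP=> BC; rewrite BC in xB; have /(repP _ _ yC)/fE[c1y _] := xB.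
      have [e] := coord_step Hc1 xy; rewrite -c1y -[LHS]addr0 => /addrI/esym/eqP.
      by rewrite (negPf (sg_neq0 _ _)).
    by apply/existsP; exists x; rewrite xB; apply/existsP; exists y; rewrite yC.
  case/andP=> _ /existsP[x /andP[xB /existsP[y /andP[yC xy]]]].
  by rewrite (FE _ _ xB) (FE _ _ yC); apply: fadj.
- exact: iso.
- move=> g B C gG CE; have [x xB] := inh B.
  have gxC : g x \in val C by rewrite CE imset_f.
  by rewrite (FE _ _ xB) (FE _ _ gxC) phiE //= thetaE.
Qed.

Lemma quot_coord (N' : {group {perm P}}) t (c : P -> 'Z_t) (d : T -> 'Z_t) :
  is_coord N' c -> N' <| G -> (forall x, d (f x) = c x) ->
  @is_coord L (theta @* orbker_group N') t d.
Proof.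
move=> Hc nN fd; have [_ cadj cS] := Hc; split.
- move=> u v; have [x <-] := fsurj u; have [y <-] := fsurj v; apply/orbitP/eqP.
    case=> _ /morphimP[g gG /(orbkerP Hc)[_ gc] ->];
      rewrite /= /aperm thetaE // => <-.
    by rewrite !fd gc.
  rewrite !fd => /(coord_fib Hc)[g gN <-]; have gG := subsetP (normal_sub nN) _ gN.
  exists (theta g); last by rewrite /= /aperm thetaE.
  apply: mem_morphim => //; apply/(orbkerP Hc); split=> // z.
  by rewrite (coord_fix Hc).
- move=> u v; have [x <-] := fsurj u => /flift[y /cadj[e cy] <-].
  by exists e; rewrite !fd.
- move=> u e; have [x <-] := fsurj u; have [y xy cy] := cS x e.
  by exists (f y); [apply: fadj | rewrite !fd].
Qed.

Lemma quot_darc x v d : @darc L d (f x) v -> exists2 y, darc d x y & f y = v.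
Proof.
move=> xv; have axv := darc_adj quot_OG4 xv.
have [y [_ fy dE]] := fadjE axv; exists y; rewrite // dE.
by case: (d) xv.
Qed.

Lemma darc_quot x y d : darc d x y -> @darc L d (f x) (f y).
Proof.
move=> xy; have axy := darc_adj HP xy.
by case: d xy => /= xy; rewrite farc // (og_sym HP).
Qed.

Lemma quot_oriented t (c : P -> 'Z_t) (d : T -> 'Z_t) :
  (forall x, d (f x) = c x) -> oriented c -> @oriented L t d.
Proof.
move=> fd [e o]; exists e => u v; have [x <-] := fsurj u.
by case/quot_darc=> y /o cy <-; rewrite !fd.
Qed.

Lemma quot_unoriented t (c : P -> 'Z_t) (d : T -> 'Z_t) :
  (forall x, d (f x) = c x) -> unoriented c -> @unoriented L t d.
Proof.
move=> fd un u d' e; have [x <-] := fsurj u; have [y [xy cy uy]] := un x d' e.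
exists (f y); split; first exact: darc_quot.
  by rewrite !fd.
move=> v /quot_darc[z xz <-]; rewrite !fd => cz; congr f; exact: uy.
Qed.

Lemma quot_fix_trivial p : p \in theta @* G -> (forall u, d1 (p u) = d1 u) ->
  (forall u, d2 (p u) = d2 u) -> p = 1.
Proof.
case/morphimP=> g gG _ -> h1 h2; apply/permP=> u; have [x <-] := fsurj u.
rewrite perm1 thetaE //; apply/esym/fK; apply: mem_orbit; apply/KP; split=> // y.
  by rewrite -!fd1 -thetaE // h1.
by rewrite -!fd2 -thetaE // h2.
Qed.

(** Downstairs, an element keeping both coordinates is trivial. The quotient defining independence
    is therefore the 4-valent graph itself. *)
Lemma quot_independent :
  [/\ @independent_cyclic_quotients L (theta @* orbker_group N)
         (theta @* orbker_group M) r s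
    & theta @* orbker_group N :&: theta @* orbker_group M = 1].
Proof.
have C1 := quot_coord Hc1 nNG fd1; have C2 := quot_coord Hc2 nMG fd2.
have fix_orb t (c : P -> 'Z_t) d (N' : {group {perm P}}) p u :
    is_coord N' c -> (forall x, d (f x) = c x) ->
    p \in theta @* orbker_group N' -> d (p u) = d u.
  move=> Hc fd /morphimP[g gG /(orbkerP Hc)[_ gc] ->].
  by have [x <-] := fsurj u; rewrite thetaE // !fd.
split; last first.
  apply/trivgP/subsetP=> p /setIP[pN pM]; apply/set1P.
  apply: quot_fix_trivial.
  - by case/morphimP: pN => g gG _ ->; apply: mem_morphim.
  - by move=> u; apply: fix_orb Hc1 fd1 pN.
  - by move=> u; apply: fix_orb Hc2 fd2 pM.
split.
- exact: morphim_normal (orbker_normal nNG Hc1).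
- exact: morphim_normal (orbker_normal nMG Hc2).
- exact: (@coord_cycle L _ r d1 r3 (f x0) C1).
- exact: (@coord_cycle L _ s d2 s3 (f x0) C2).
case=> k k3; have -> : @orbker L (theta @* orbker_group N) :&:
    @orbker L (theta @* orbker_group M) = 1.
  apply/trivgP/subsetP=> p /setIP[/(orbkerP C1)[pG p1] /(orbkerP C2)[_ p2]].
  by apply/set1P; apply: quot_fix_trivial.
exact: (@valency4_not_cycle L (f x0) k quot_OG4 k3).
Qed.

Hypothesis u1 : unoriented c1.
Variable H : {group {perm T}}.
Local Notation LH := (@GPair T a H D).
Hypothesis sH : H \subset @arc_part LH _ d1.
Hypothesis tH : @arc_transitive LH H.

(** Both groups lie in [arc_part] for the unoriented first coordinate and are arc-transitive, so
    each contains the other. *)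
Lemma quot_pairE : quot_pair = LH.
Proof.
have C1 := quot_coord Hc1 nNG fd1; have U1 := quot_unoriented fd1 u1.
suff eqH : (theta @* G)%G = H by rewrite /quot_pair eqH.
have sG : theta @* G \subset @arc_part L _ d1.
  apply/subsetP=> p /theta_lift[g gG pE]; apply/arc_partP; split.
    move=> d u v; have [x <-] := fsurj u; rewrite pE.
    have [y <-] := fsurj v; rewrite pE; apply/idP/idP.
      case/quot_darc=> z gxz /f_grp-/(_ _ (groupVr gG)); rewrite permK => <-.
      by apply: darc_quot; rewrite -(darc_grp HP _ _ _ gG) permKV.
    case/quot_darc=> z xz /(f_grp gG) <-; apply: darc_quot.
    by rewrite (darc_grp HP).
  move=> u v; have [x <-] := fsurj u; have [y <-] := fsurj v.
  by rewrite !pE !fd1 (coord_grp nNG Hc1).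
have tG : @arc_transitive L (theta @* G).
  move=> u v u' v'; have [x <-] := fsurj u; have [x' <-] := fsurj u'.
  case/quot_darc=> y xy <- /quot_darc[y' xy' <-].
  have [g gG [gx gy]] := arc_trans HP xy xy'.
  by have [p pG pE] := lift_theta gG; exists p; rewrite // !pE gx gy.
apply/eqP; rewrite -val_eqE eqEsubset; apply/andP; split.
  exact: (arc_part_sub quot_OG4 C1 U1 sG sH tH (f x0)).
exact: (arc_part_sub quot_OG4 C1 U1 sH sG tG (f x0)).
Qed.

Lemma model_realised : exists N' M' : {group {perm LH}},
  [/\ OG4 LH, normal_cover P LH, independent_cyclic_quotients N' M' r s,
      N' :&: M' = 1
    & (oriented c2 -> G_oriented M') /\ (unoriented c2 -> ~ G_oriented M')].
Proof.
rewrite -quot_pairE.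
exists (theta @* orbker_group N)%G, (theta @* orbker_group M)%G.
have [I1 I2] := quot_independent.
have C2 := quot_coord Hc2 nMG fd2.
split=> //; first exact: quot_OG4.
  exact: quot_normal_cover.
split.
  move/(quot_oriented fd2); exact: oriented_G_oriented quot_OG4 s3 C2.
move/(quot_unoriented fd2); exact: unoriented_not_G_oriented quot_OG4 C2 (f x0).
Qed.

End Transfer.

(** * Local structure of a pair with independent cyclic quotients *)

Section Parity.
Local Open Scope ring_scope.
Variable r : nat.
Hypotheses (r1 : (1 < r)%N) (r_even : ~~ odd r).

Lemma odd_ZpD (i j : 'Z_r) : odd (i + j)%R = odd i (+) odd j.
Proof. by rewrite /= odd_mod ?oddD // Zp_cast // (negbTE r_even). Qed.

Lemma odd_Zp_succ (i : 'Z_r) : odd (i + 1)%R = ~~ odd i.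
Proof. by rewrite odd_ZpD addbT. Qed.

Lemma odd_ZpN (i : 'Z_r) : odd (- i)%R = odd i.
Proof.
by have := odd_ZpD (- i) i; rewrite addNr /=; case: (odd _) (odd i) => [] [].
Qed.

Lemma odd_Zp_sg (i : 'Z_r) e : odd (i + sg e)%R = ~~ odd i.
Proof. by case: e; rewrite /sg ?expr1 ?expr0 odd_ZpD ?odd_ZpN addbT. Qed.

End Parity.

(** Adding the odd modulus to a representative changes its parity. *)
Lemma Zp_parity_repr r (i : 'Z_r) b : 1 < r -> odd r ->
  exists2 m, odd m = b & (m%:R = i)%R.
Proof.
move=> r1 r_odd; have [ib|ib] := eqVneq (odd i) b; first by exists i;
  rewrite // natr_Zp.
exists (i + r); first by rewrite oddD r_odd addbT; case: (odd i) b ib => [] [].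
by rewrite natrD natr_Zp pchar_Zp // addr0.
Qed.

Section LocalStructure.
Local Open Scope ring_scope.
Variables (P : gpair) (N M : {group {perm P}}) (r s : nat).
Hypotheses (HP : OG4 P) (r3 : (3 <= r)%N) (s3 : (3 <= s)%N).
Hypotheses (nNG : N <| grp P) (nMG : M <| grp P).
Variables (c1 : P -> 'Z_r) (c2 : P -> 'Z_s).
Hypotheses (Hc1 : is_coord N c1) (Hc2 : is_coord M c2).
Hypothesis loc : forall x y y',
  adj x y -> adj x y' -> c1 y = c1 y' -> c2 y = c2 y' -> y = y'.
Hypothesis u1 : unoriented c1.
Local Notation K := (orbker_group N :&: orbker_group M)%G.

(** An out-neighbour and an in-neighbour both make the step [a] in [c1]. They are distinct, so by
    [loc] they make different steps in [c2]. *)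
Lemma lift_nbr x a b :
  exists y, [/\ adj x y, c1 y = c1 x + sg a & c2 y = c2 x + sg b].
Proof.
have [y [xy cy _]] := u1 x true a; have [z [xz cz _]] := u1 x false a.
have [axy axz] := (darc_adj HP xy, darc_adj HP xz).
have [b' cy2] := coord_step Hc2 axy.
have [bb|bb] := eqVneq b' b; first by exists y; rewrite -bb.
have ne : c2 z <> c2 y.
  move=> c2zy; have zy : z = y by apply: loc axz axy _ c2zy; rewrite cz cy.
  by move: xz; rewrite zy; apply/negP; apply: (darcNC HP xy).
exists z; split=> //; rewrite (coord_two Hc2 axy axz cy2 ne).
by case: b b' bb {cy2} => [] [].
Qed.

(** [Q] follows a boolean that flips along each edge. The walk first makes at most one diagonal
    step, to get the parity right, and then adds 2 to one coordinate at a time, each time along two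
    edges. *)
Lemma reach (x0 : P) (Q : P -> bool -> Prop) m n : c1 x0 = 0 -> c2 x0 = 0 ->
  Q x0 false -> (forall x y b, Q x b -> adj x y -> Q y (~~ b)) ->
  odd m = odd n -> exists p, [/\ c1 p = m%:R, c2 p = n%:R & Q p (odd m)].
Proof.
move=> z1 z2 Q0 Qs.
pose E m n b := exists p, [/\ c1 p = m%:R, c2 p = n%:R & Q p b].
have step i j k b : E i j b -> exists p, [/\ c1 p = i.+1%:R,
    c2 p = j%:R + sg k & Q p (~~ b)].
  case=> p [p1 p2 Qp]; have [q [pq q1 q2]] := lift_nbr p false k.
  exists q; split; last exact: Qs _ _ _ Qp pq.
    by rewrite q1 p1 -natr1.
  by rewrite q2 p2.
have E1 i j b : E i j b -> E i.+1 j.+1 (~~ b).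
  by case/(step _ _ false)=> p [p1 p2 Qp]; exists p; split; rewrite // p2 -natr1.
have E20 i j b : E i j b -> E i.+2 j b.
  case/E1=> p [p1 p2 Qp]; have [q [pq q1 q2]] := lift_nbr p false true.
  exists q; split; first by rewrite q1 p1 -[RHS]natr1.
    by rewrite q2 p2 -natr1 /sg expr1 addrK.
  by rewrite -[b]negbK; apply: Qs _ _ _ _ pq.
have E02 i j b : E i j b -> E i j.+2 b.
  case/E1=> p [p1 p2 Qp]; have [q [pq q1 q2]] := lift_nbr p true false.
  exists q; split; last by rewrite -[b]negbK; apply: Qs _ _ _ _ pq.
    by rewrite q1 p1 -natr1 /sg expr1 addrK.
  by rewrite q2 p2 -[RHS]natr1.
have E0 (b : bool) : E b b b.
  have e0 : E 0%N 0%N false by exists x0.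
  by case: b => //; apply: (E1 0%N 0%N false).
move=> mn; suff : E m n (odd m) by [].
rewrite -[X in E X _ _]odd_double_half -[X in E _ X _]odd_double_half -mn.
elim: (m./2) => [|k IHk]; last by rewrite doubleS !addnS; apply: E20.
elim: (n./2) => [|k IHk]; last by rewrite doubleS !addnS; apply: E02.
by rewrite !addn0.
Qed.

(** The element carrying one arc to the other keeps both coordinates along an edge, hence everywhere
    by rigidity. *)
Lemma K_orbitI x y x' y' : c1 x = c1 y -> c2 x = c2 y ->
  darc true x x' -> darc true y y' -> c1 x' = c1 y' -> c2 x' = c2 y' ->
  y \in orbit 'P K x.
Proof.
move=> e1 e2 xx yy e1' e2'.
have [g gG [gx gx']] := arc_trans HP xx yy.
apply/orbitP; exists g; last exact: gx.
have axx := darc_adj HP xx.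
apply/(KP Hc1 Hc2); split=> //.
  by apply: (coord_rigid HP nNG Hc1 gG axx); rewrite ?gx ?gx'.
by apply: (coord_rigid HP nMG Hc2 gG axx); rewrite ?gx ?gx'.
Qed.

Lemma K_orbitE x y : y \in orbit 'P K x -> c1 x = c1 y /\ c2 x = c2 y.
Proof. by case/orbitP=> k /(KP Hc1 Hc2)[_ k1 k2] <-; rewrite k1 k2. Qed.

Section Oriented.
Hypothesis o2 : forall x y, darc true x y -> c2 y = c2 x + sg false.

Lemma oriented_arcs x y : adj x y ->
  ((x, y) \in arcs P) = (c2 y == c2 x + sg false).
Proof.
move=> xy; apply/idP/eqP; first exact: (o2 (x := x)).
move=> cy; apply: contraT => nxy.
have yx : darc true y x by rewrite -darcN darc_adjE.
move: cy; rewrite (sgK (o2 yx)) => /(sg_neq s3); discriminate.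
Qed.

Lemma oriented_orbit x y :
  y \in orbit 'P K x <-> c1 x = c1 y /\ c2 x = c2 y.
Proof.
split=> [|[e1 e2]]; first exact: K_orbitE.
have [x' [xx x1 _]] := u1 x true false; have [y' [yy y1 _]] := u1 y true false.
apply: (K_orbitI e1 e2 xx yy); first by rewrite x1 y1 e1.
by rewrite (o2 xx) (o2 yy) e2.
Qed.

End Oriented.

Section Unoriented.
Hypothesis u2 : unoriented c2.

(* The out-neighbours of x lie over (c1 x, c2 x) +- (1, sg (vtype x)). *)
Definition vtype x := [exists y, [&& darc true x y,
  c1 y == c1 x + sg false & c2 y == c2 x + sg true]].

(** The type is read off the out-neighbour with [c1]-step +1; the other out-neighbour reverses both
    steps because both coordinates are unoriented. *)
Lemma vtype_out x y a : darc true x y -> c1 y = c1 x + sg a ->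
  c2 y = c2 x + sg (a (+) vtype x).
Proof.
have [y0 [xy0 c1y0 u0]] := u1 x true false.
have [b c2y0] := coord_step Hc2 (darc_adj HP xy0).
have tE : vtype x = b.
  apply/existsP/idP.
    case=> z /and3P[xz /eqP c1z /eqP c2z].
    have zy : z = y0 by apply: u0; rewrite // c1z c1y0.
    by move: c2z; rewrite zy c2y0 => /(sg_neq s3) ->.
  by move=> bT; exists y0; rewrite xy0 c1y0 c2y0 bT !eqxx.
move=> xy; rewrite tE; case: a => c1y; last first.
  by have -> : y = y0 by apply: u0; rewrite // c1y c1y0.
apply: (coord_two Hc2 (darc_adj HP xy0) (darc_adj HP xy) c2y0) => c2y.
have yy := unoriented_inj HP Hc2 u2 xy xy0 c2y.
by move: c1y; rewrite yy c1y0 => /(sg_neq r3).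
Qed.

(** By [loc], an in-neighbour with a given [c1]-step has the [c2]-step opposite to that of the
    out-neighbour with the same [c1]-step. *)
Lemma vtypeP x y d a : darc d x y -> c1 y = c1 x + sg a ->
  c2 y = c2 x + sg (a (+) vtype x (+) ~~ d).
Proof.
case: d => xy c1y; first by rewrite addbF; apply: vtype_out.
have [z [xz c1z _]] := u1 x true a.
rewrite addbT; apply: (coord_two Hc2 (darc_adj HP xz) (darc_adj HP xy)).
  exact: vtype_out.
move=> c2yz; have yz : y = z.
  apply: (loc (darc_adj HP xy) (darc_adj HP xz) _ c2yz).
  by rewrite c1y c1z.
by move: xy; rewrite yz; apply/negP; apply: (darcNC HP xz).
Qed.

(** Reading an edge from its other end reverses both steps, which leaves their product unchanged,
    and reverses the direction, which the type must compensate. *)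
Lemma vtype_flip x y : adj x y -> vtype y = ~~ vtype x.
Proof.
move=> xy; have [d dxy] := adj_darc HP xy; have [a c1y] := coord_step Hc1 xy.
have dyx : darc (~~ d) y x by rewrite darcN.
have := vtypeP dyx (sgK c1y); rewrite (sgK (vtypeP dxy c1y)).
move/(sg_neq s3); case: (vtype x) (vtype y) a d {c1y dxy dyx} => [] [] [] [] //.
Qed.

Lemma vtype_arcs x y a b : adj x y -> c1 y = c1 x + sg a ->
  c2 y = c2 x + sg b -> ((x, y) \in arcs P) = (a (+) b == vtype x).
Proof.
move=> xy c1y c2y; have [d dxy] := adj_darc HP xy.
have -> : ((x, y) \in arcs P) = d.
  case: d dxy => // dxy; apply/negbTE; exact: (darcNC HP (d := false) dxy).
move: c2y; rewrite (vtypeP dxy c1y) => /(sg_neq s3) <-.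
by case: (vtype x) a d {c1y dxy} => [] [] [].
Qed.

Lemma unoriented_orbit x y :
  y \in orbit 'P K x <-> [/\ c1 x = c1 y, c2 x = c2 y & vtype x = vtype y].
Proof.
split=> [yx|[e1 e2 et]].
  have [e1 e2] := K_orbitE yx; split=> //.
  case/orbitP: yx e1 e2 => k /(KP Hc1 Hc2)[kG k1 k2] <- e1 e2.
  have [z [xz c1z _]] := u1 x true false.
  have kxz : darc true (k x) (k z) by rewrite (darc_grp HP).
  have c1kz : c1 (k z) = c1 (k x) + sg false by rewrite !k1.
  have := vtypeP kxz c1kz; rewrite !k2 (vtypeP xz c1z) => /(sg_neq s3).
  by rewrite !addbF !addFb.
have [x' [xx x1 _]] := u1 x true false; have [y' [yy y1 _]] := u1 y true false.
apply: (K_orbitI e1 e2 xx yy); first by rewrite x1 y1 e1.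
by rewrite (vtypeP xx x1) (vtypeP yy y1) e2 et.
Qed.

End Unoriented.
End LocalStructure.

(** * The model pairs *)

Lemma arc_part_intro (L : gpair) (T : eqType) (d : L -> T) (h : {perm L}) :
  (forall u v, (u, v) \in arcs L -> (h u, h v) \in arcs L) ->
  (forall u v, d u = d v -> d (h u) = d (h v)) -> h \in arc_part d.
Proof.
move=> harc hd.
have X n : (forall u v, (u, v) \in arcs L -> ((h ^+ n) u, (h ^+ n) v) \in arcs L) /\
    (forall u v, d u = d v -> d ((h ^+ n) u) = d ((h ^+ n) v)).
  elim: n => [|n [IH1 IH2]]; first by split=> u v; rewrite !perm1.
  split=> u v uv; rewrite expgSr !permM; first exact/harc/IH1.
  exact/hd/IH2.
(* Preservation in one direction suffices, as h^-1 is a power of h. *)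
have := X #[h].-1; rewrite -invg_expg => -[varc vd].
apply/arc_partP; split=> [e u v|u v].
  suff E u' v' : ((h u', h v') \in arcs L) = ((u', v') \in arcs L) by case: e => /=.
  by apply/idP/idP=> [/varc|/harc//]; rewrite !permK.
by apply/eqP/eqP=> [/vd|/hd//]; rewrite !permK.
Qed.

(** Vertex-transitivity brings any arc to one leaving [b], and [t] exchanges the candidates for its
    head. *)
Lemma arc_transitive_intro (L : gpair) (T : eqType) (d : L -> T)
    (H : {group {perm L}}) (b v : L) (t : {perm L}) :
  H \subset arc_part d -> (forall u, exists2 h, h \in H & h b = u) ->
  t \in H -> t b = b -> (forall w, darc true b w -> w = v \/ w = t v) ->
  arc_transitive H.
Proof.
move=> sH tr tH tb out.
have base x y : darc true x y -> exists2 h, h \in H & h b = x /\ h v = y.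
  move=> xy; have [h hH hb] := tr x; have hiH := groupVr hH.
  have /arc_partP[hd _] := subsetP sH _ hiH.
  have : darc true b (h^-1 y) by rewrite -(hd true) in xy;
    rewrite -{1}(permK h b) hb.
  case/out=> [e|e]; first by exists h; rewrite // hb -e permKV.
  by exists (t * h); rewrite ?groupM // !permM tb hb -e permKV.
move=> x y x' y' /base[h hH [hb hv]] /base[k kH [kb kv]].
by exists (h^-1 * k); rewrite ?groupM ?groupV // !permM -hb -hv !permK.
Qed.

Section Models.
Local Open Scope ring_scope.
Variables r s : nat.
Hypotheses (r1 : (1 < r)%N) (s1 : (1 < s)%N).
Implicit Types (u v : X r s).

Lemma adjXP u v :
  reflect (exists a b, v = (u.1 + sg a, u.2 + sg b)) (adjX u v).
Proof.
apply: (iffP andP) => [[/orP h1 /orP h2]|[a [b ->]]]; last first.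
  by rewrite /=; case: a; case: b; rewrite /sg ?expr1 ?expr0 !eqxx ?orbT.
have {h1}[a e1] : exists a, v.1 = u.1 + sg a.
  by case: h1 => /eqP->; [exists false | exists true].
have {h2}[b e2] : exists b, v.2 = u.2 + sg b.
  by case: h2 => /eqP->; [exists false | exists true].
by exists a, b; rewrite -e1 -e2; case: (v).
Qed.

Lemma arcsGP u v :
  reflect (exists a, v = (u.1 + sg a, u.2 + sg false)) ((u, v) \in arcsG r s).
Proof.
rewrite inE /=; apply: (iffP andP) => [[/orP h1 /eqP h2]|[a ->]]; last first.
  by rewrite /=; case: a; rewrite /sg ?expr1 ?expr0 !eqxx ?orbT.
have {h1}[a e1] : exists a, v.1 = u.1 + sg a.
  by case: h1 => /eqP->; [exists false | exists true].
by exists a; rewrite -e1 /sg expr0 -h2; case: (v).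
Qed.

Lemma arcsHP u v :
  reflect (exists a, v = (u.1 + sg a, u.2 + sg (a (+) odd u.2)))
          ((u, v) \in arcsH r s).
Proof.
rewrite inE /= -signr_odd -/(sg (odd u.2)) -(sgN s (odd u.2)).
apply: (iffP orP) => [[]/eqP->|[[] ->]].
- by exists false.
- by exists true.
- by right.
- by left.
Qed.

Lemma muXE n u : (mu r s ^+ n)%g u = (u.1 + n%:R, u.2).
Proof.
elim: n => [|n IHn]; first by rewrite perm1 addr0; case: u.
by rewrite expgSr permM IHn permE /mu_fun /= -addrA natr1.
Qed.

Lemma nuXE n u : (nu r s ^+ n)%g u = (u.1, u.2 + n%:R).
Proof.
elim: n => [|n IHn]; first by rewrite perm1 addr0; case: u.
by rewrite expgSr permM IHn permE /nu_fun /= -addrA natr1.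
Qed.

Definition part1 (u : X r s) : 'Z_r := u.1.
Definition part2 (u : X r s) : 'Z_s := u.2.

Lemma mu_arcsG : mu r s \in @arc_part (pairG r s) _ part1.
Proof.
apply: arc_part_intro => u v; last by rewrite !permE /part1 /= => ->.
case/arcsGP=> a ->; rewrite !permE; apply/arcsGP; exists a.
by rewrite /mu_fun /= addrAC.
Qed.

Lemma nu_arcsG : nu r s \in @arc_part (pairG r s) _ part1.
Proof.
apply: arc_part_intro => u v; last by rewrite !permE /part1 /= => ->.
case/arcsGP=> a ->; rewrite !permE; apply/arcsGP; exists a.
by rewrite /nu_fun /= addrAC.
Qed.

Lemma sigma_arcsG : sigma r s \in @arc_part (pairG r s) _ part1.
Proof.
apply: arc_part_intro => u v; last by rewrite !permE /part1 /= => ->.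
case/arcsGP=> a ->; rewrite !permE; apply/arcsGP; exists (~~ a).
by rewrite /sigma_fun /= opprD sgN.
Qed.

Lemma grpG_arc_part : grp (pairG r s) \subset @arc_part (pairG r s) _ part1.
Proof.
rewrite gen_subG; apply/subsetP=> h /setUP[/set2P[]|/set1P] ->.
- exact: mu_arcsG.
- exact: nu_arcsG.
- exact: sigma_arcsG.
Qed.

Lemma base_arcsG w : ((0, 0), w) \in arcsG r s ->
  w = (1, 1) \/ w = sigma r s (1, 1).
Proof.
case/arcsGP=> -[] ->; rewrite permE /sigma_fun /sg /= !add0r ?expr0 ?expr1.
  by right.
by left.
Qed.

Lemma grpG_arc_transitive : @arc_transitive (pairG r s) (grp (pairG r s)).
Proof.
have mem h : h \in [set mu r s; nu r s; sigma r s] -> h \in grp (pairG r s).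
  by move=> hS; apply: mem_gen.
apply: (@arc_transitive_intro (pairG r s) _ part1 _ ((0, 0) : X r s)
  ((1, 1) : X r s) (sigma r s) grpG_arc_part) => [u|||w]; last exact: base_arcsG.
- exists (mu r s ^+ u.1 * nu r s ^+ u.2)%g.
    by rewrite groupM ?groupX ?mem // !inE eqxx ?orbT.
  by rewrite permM muXE nuXE /= !add0r !natr_Zp; case: u.
- by apply: mem; rewrite !inE eqxx !orbT.
- by rewrite permE /sigma_fun /= oppr0.
Qed.

Section H.
Hypothesis s_even : ~~ odd s.

Lemma mu_arcsH u v :
  (u, v) \in arcsH r s -> (mu r s u, mu r s v) \in arcsH r s.
Proof.
case/arcsHP=> a ->; rewrite !permE; apply/arcsHP; exists a.
by rewrite /mu_fun /= addrAC.
Qed.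

(** The values [i = 0] and [i = 1] cover [sigma * nu] and [sigma * mu * nu]. The reflection flips
    [a] and the shift flips the parity of the second component, so its step is unchanged. *)
Lemma nu_sigma_arcsH (i : 'Z_r) u v : (u, v) \in arcsH r s ->
  ((i - u.1, u.2 + 1), (i - v.1, v.2 + 1)) \in arcsH r s.
Proof.
case/arcsHP=> a ->; apply/arcsHP; exists (~~ a).
by rewrite /= sgN opprD addrA (odd_Zp_succ s1 s_even) addrAC addNb addbN negbK;
  congr pair; rewrite addrAC.
Qed.

Lemma tau_arcsH u v :
  (u, v) \in arcsH r s -> (tau r s u, tau r s v) \in arcsH r s.
Proof.
case/arcsHP=> a ->; rewrite !permE; apply/arcsHP; exists (~~ a).
by rewrite /tau_fun /= (odd_ZpN s1 s_even) addNb !sgN !opprD.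
Qed.

Lemma sigma_nuE u : (sigma r s * nu r s)%g u = (- u.1, u.2 + 1).
Proof. by rewrite permM !permE. Qed.

Lemma sigma_mu_nuE u : (sigma r s * mu r s * nu r s)%g u = (1 - u.1, u.2 + 1).
Proof. by rewrite !permM !permE /nu_fun /= addrC. Qed.

Lemma sigma_nu_arcsH u v : (u, v) \in arcsH r s ->
  ((sigma r s * nu r s)%g u, (sigma r s * nu r s)%g v) \in arcsH r s.
Proof. by move/(nu_sigma_arcsH 0); rewrite !sigma_nuE !sub0r. Qed.

Lemma grpH_arc_part (T : eqType) (d : X r s -> T) :
  (forall h, h \in [set mu r s; (sigma r s * nu r s)%g; tau r s] ->
   forall u v, d u = d v -> d (h u) = d (h v)) ->
  grp (pairH r s) \subset @arc_part (pairH r s) _ d.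
Proof.
move=> hd; rewrite gen_subG; apply/subsetP=> h hS.
apply: (@arc_part_intro (pairH r s) _ d h _ (hd _ hS)) => u v.
case/setUP: hS => [/set2P[]|/set1P] ->.
- exact: mu_arcsH.
- exact: sigma_nu_arcsH.
- exact: tau_arcsH.
Qed.

Lemma grpH_part1 : grp (pairH r s) \subset @arc_part (pairH r s) _ part1.
Proof.
apply: grpH_arc_part => h /setUP[/set2P[]|/set1P] -> u v;
  by rewrite /part1 ?sigma_nuE ?permE /= => ->.
Qed.

Lemma grpH_part2 : grp (pairH r s) \subset @arc_part (pairH r s) _ part2.
Proof.
apply: grpH_arc_part => h /setUP[/set2P[]|/set1P] -> u v;
  by rewrite /part2 ?sigma_nuE ?permE /= => ->.
Qed.

Lemma base_arcsH w : ((0, 0), w) \in arcsH r s ->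
  w = (1, 1) \/ w = tau r s (1, 1).
Proof.
case/arcsHP=> -[] ->; rewrite permE /tau_fun /sg /= !add0r ?expr0 ?expr1.
  by right.
by left.
Qed.

Lemma grpH_arc_transitive : @arc_transitive (pairH r s) (grp (pairH r s)).
Proof.
have mem h : h \in [set mu r s; (sigma r s * nu r s)%g; tau r s] ->
    h \in grp (pairH r s) by move=> hS; apply: mem_gen.
apply: (@arc_transitive_intro (pairH r s) _ part1 _ ((0, 0) : X r s)
  ((1, 1) : X r s) (tau r s) grpH_part1) => [u|||w]; last exact: base_arcsH.
- have snX n : ((sigma r s * nu r s) ^+ n)%g (0, 0) = (0, n%:R).
    elim: n => [|n IHn]; first by rewrite perm1.
    by rewrite expgSr permM IHn sigma_nuE /= oppr0 natr1.
  exists ((sigma r s * nu r s) ^+ u.2 * mu r s ^+ u.1)%g.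
    by rewrite groupM ?groupX ?mem // !inE eqxx ?orbT.
  by rewrite permM snX muXE /= !add0r !natr_Zp; case: u.
- by apply: mem; rewrite !inE eqxx !orbT.
- by rewrite permE /tau_fun /= !oppr0.
Qed.

End H.

(** * Restriction of arcs and groups to the even part *)

Section Restriction.
Variables (S : {set {perm X r s}}) (D : {set X r s * X r s}).
Local Notation L0 := (@GPair (X r s) (@adjX r s) 1%G D).
Local Notation Lp :=
  (@GPair (Xp r s) (@adjXp r s) (<<restr_perms S>>)%G (restr_arcs D)).

Lemma restr_arc_part (T : eqType) (d : X r s -> T) :
  S \subset @arc_part L0 _ d ->
  grp Lp \subset @arc_part Lp _ (fun x => d (val x)).
Proof.
move=> sS; rewrite gen_subG; apply/subsetP=> p.
rewrite inE => /existsP[g /andP[gS /forallP pE]].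
have {}pE x : val (p x) = g (val x) by apply/eqP.
have /arc_partP[garc gd] := subsetP sS _ gS.
apply: arc_part_intro => [u v|u v]; first by rewrite !inE /= !pE;
  have /= -> := garc true (val u) (val v).
by rewrite !pE => duv; apply/eqP; rewrite gd duv.
Qed.

Lemma restr_mem g : g \in S -> (forall x, Xplus x -> Xplus (g x)) ->
  exists2 p, p \in grp Lp & forall n (x :
    Xp r s), val ((p ^+ n)%g x) = (g ^+ n)%g (val x).
Proof.
move=> gS gX.
pose h (x : Xp r s) : Xp r s := exist _ (g (val x)) (gX _ (valP x)).
have h_inj : injective h by move=> x y [/perm_inj/val_inj].
exists (perm h_inj).
  apply: mem_gen; rewrite inE; apply/existsP; exists g; rewrite gS.
  by apply/forallP=> x; rewrite permE.
elim=> [|n IHn] x; first by rewrite !perm1.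
by rewrite !expgSr !permM permE /= IHn.
Qed.

End Restriction.

Section EvenEven.
Hypotheses (r_even : ~~ odd r) (s_even : ~~ odd s).

(** The number [n * r.-1] represents -n modulo r. As r - 1 is odd, the sum is even, and its half
    serves as an exponent of [mu ^+ 2]. *)
Lemma half_add (m n : nat) : odd m = odd n ->
  n%:R + ((m + n * r.-1)./2 * 2)%:R = m%:R :> 'Z_r.
Proof.
move=> mn; rewrite -natrD muln2.
have odd0 : odd (m + n * r.-1) = false.
  rewrite oddD oddM mn; case: (r) r1 r_even => // r' _; rewrite /= negbK => ->.
  by rewrite andbT addbb.
have -> : (m + n * r.-1)./2.*2 = (m + n * r.-1)%N.
  by rewrite -[RHS]odd_double_half odd0.
rewrite addnCA -mulnS prednK; last exact: ltnW.
by rewrite natrD natrM pchar_Zp // mulr0 addr0.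
Qed.

Lemma XplusE (i : 'Z_r) (j : 'Z_s) : Xplus (i, j) = (odd i == odd j).
Proof. by []. Qed.

Lemma mu2_Xplus (x : X r s) : Xplus x -> Xplus ((mu r s ^+ 2)%g x).
Proof.
case: x => i j; rewrite muXE !XplusE => /eqP <-.
have -> : i + 2%:R = i + 1 + 1 by rewrite -addrA.
by rewrite !(odd_Zp_succ r1 r_even) negbK.
Qed.

Lemma mu_nuE (x : X r s) : (mu r s * nu r s)%g x = (x.1 + 1, x.2 + 1).
Proof. by rewrite permM !permE. Qed.

Lemma mu_nu_Xplus (x : X r s) : Xplus x -> Xplus ((mu r s * nu r s)%g x).
Proof.
case: x => i j; rewrite mu_nuE !XplusE => /eqP ij.
by rewrite (odd_Zp_succ r1 r_even) (odd_Zp_succ s1 s_even) ij.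
Qed.

Lemma sigma_mu_nu_Xplus (x : X r s) :
  Xplus x -> Xplus ((sigma r s * mu r s * nu r s)%g x).
Proof.
case: x => i j; rewrite sigma_mu_nuE !XplusE => /eqP ij.
by rewrite addrC (odd_Zp_succ r1 r_even) (odd_Zp_succ s1 s_even) (odd_ZpN r1
  r_even) ij.
Qed.

Lemma sigma_Xplus (x : X r s) : Xplus x -> Xplus (sigma r s x).
Proof. by case: x => i j; rewrite permE !XplusE (odd_ZpN r1 r_even). Qed.

Lemma tau_Xplus (x : X r s) : Xplus x -> Xplus (tau r s x).
Proof. by case: x => i j; rewrite permE !XplusE (odd_ZpN r1 r_even) (odd_ZpN s1
  s_even). Qed.

Definition baseXp : Xp r s := exist _ (0, 0) isT.
Definition nbrXp : Xp r s := exist _ (1, 1) isT.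

Lemma grpGplus_arc_part :
  grp (pairGplus r s) \subset @arc_part (pairGplus r s) _ (fun x => part1 (val x)).
Proof.
apply: restr_arc_part; apply/subsetP=> h.
suff : h \in [set (mu r s ^+ 2)%g; (mu r s * nu r s)%g; sigma r s] ->
  h \in @arc_part (pairG r s) _ part1 by [].
case/setUP=> [/set2P[]|/set1P] ->.
- by apply: groupX; apply: mu_arcsG.
- by apply: groupM; [apply: mu_arcsG | apply: nu_arcsG].
- exact: sigma_arcsG.
Qed.

Lemma grpGplus_arc_transitive :
  @arc_transitive (pairGplus r s) (grp (pairGplus r s)).
Proof.
set S := [set (mu r s ^+ 2)%g; (mu r s * nu r s)%g; sigma r s].
have S1 : (mu r s ^+ 2)%g \in S by rewrite !inE eqxx.
have S2 : (mu r s * nu r s)%g \in S by rewrite !inE eqxx orbT.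
have S3 : sigma r s \in S by rewrite !inE eqxx !orbT.
have [p2 p2G p2E] := restr_mem (arcsG r s) S1 mu2_Xplus.
have [pn pnG pnE] := restr_mem (arcsG r s) S2 mu_nu_Xplus.
have [ps psG psE] := restr_mem (arcsG r s) S3 sigma_Xplus.
apply: (@arc_transitive_intro (pairGplus r s) _ _ _ baseXp nbrXp ps
  grpGplus_arc_part) => [u||| w].
- have mnX n : ((mu r s * nu r s) ^+ n)%g ((0, 0) : X r s) = (n%:R, n%:R).
    elim: n => [|n IHn]; first by rewrite perm1.
    by rewrite expgSr permM IHn mu_nuE /= !natr1.
  have /eqP ij : odd (val u).1 == odd (val u).2 by have := valP u.
  (* Diagonal translations set the second component; the remaining even difference of the components
     is covered by powers of [mu ^+ 2]. *)
  exists (pn ^+ (val u).2 * p2 ^+ ((val u).1 + (val u).2 * r.-1)./2)%g.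
    by rewrite groupM ?groupX.
  apply: val_inj; rewrite permM p2E pnE mnX -expgM muXE /= mulnC half_add //.
  by rewrite !natr_Zp -surjective_pairing.
- exact: psG.
- by apply: val_inj; have := psE 1%N baseXp; rewrite !expg1 => ->;
  rewrite permE /sigma_fun /= oppr0.
- rewrite /= inE /= => /base_arcsG[] e; [left|right]; apply: val_inj => //.
  by apply: etrans e _; have := psE 1%N nbrXp; rewrite !expg1 => ->.
Qed.

Lemma grpHplus_arc_part :
  grp (pairHplus r s) \subset @arc_part (pairHplus r s) _ (fun x => part1 (val x)).
Proof.
apply: restr_arc_part; apply/subsetP=> h.
suff : h \in [set (mu r s ^+ 2)%g; (sigma r s * mu r s * nu r s)%g; tau r s] ->
  h \in @arc_part (pairH r s) _ part1 by [].
have sub g : g \in [set mu r s; (sigma r s * nu r s)%g; tau r s] ->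
    g \in @arc_part (pairH r s) _ part1.
  by move=> gS; apply: (subsetP (grpH_part1 s_even)); apply: mem_gen.
case/setUP=> [/set2P[]|/set1P] ->.
- by apply: groupX; apply: sub; rewrite !inE eqxx.
- apply: (@arc_part_intro (pairH r s)) => u v; rewrite !sigma_mu_nuE.
    exact: nu_sigma_arcsH.
  by rewrite /part1 /= => ->.
- by apply: sub; rewrite !inE eqxx !orbT.
Qed.

Lemma grpHplus_arc_transitive :
  @arc_transitive (pairHplus r s) (grp (pairHplus r s)).
Proof.
set S := [set (mu r s ^+ 2)%g; (sigma r s * mu r s * nu r s)%g; tau r s].
have S1 : (mu r s ^+ 2)%g \in S by rewrite !inE eqxx.
have S2 : (sigma r s * mu r s * nu r s)%g \in S by rewrite !inE eqxx orbT.
have S3 : tau r s \in S by rewrite !inE eqxx !orbT.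
have [p2 p2G p2E] := restr_mem (arcsH r s) S1 mu2_Xplus.
have [pn pnG pnE] := restr_mem (arcsH r s) S2 sigma_mu_nu_Xplus.
have [pt ptG ptE] := restr_mem (arcsH r s) S3 tau_Xplus.
apply: (@arc_transitive_intro (pairHplus r s) _ _ _ baseXp nbrXp pt
  grpHplus_arc_part) => [u||| w].
(* The glide reflection moves the first component back and forth between 0 and 1. *)
- have smnX n : ((sigma r s * mu r s * nu r s) ^+ n)%g ((0, 0) : X r s)
      = ((odd n)%:R, n%:R).
    elim: n => [|n IHn]; first by rewrite perm1.
    rewrite expgSr permM IHn sigma_mu_nuE /= natr1.
    by case: (odd n); rewrite /= ?subr0 ?subrr.
  have /eqP ij : odd (val u).1 == odd (val u).2 by have := valP u.
  (* After the first factor the first component is the parity of [(val u).2], which is that of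
     [(val u).1]; half of the rest is [(val u).1./2]. *)
  exists (pn ^+ (val u).2 * p2 ^+ (val u).1./2)%g.
    by rewrite groupM ?groupX.
  apply: val_inj; rewrite permM p2E pnE smnX -expgM muXE /= -natrD mul2n -ij.
  by rewrite odd_double_half !natr_Zp -surjective_pairing.
- exact: ptG.
- by apply: val_inj; have := ptE 1%N baseXp; rewrite !expg1 => ->;
  rewrite permE /tau_fun /= !oppr0.
- rewrite /= inE /= => /base_arcsH[] e; [left|right]; apply: val_inj => //.
  by apply: etrans e _; have := ptE 1%N nbrXp; rewrite !expg1 => ->.
Qed.

End EvenEven.

(** * The standard double cover *)

Section DoubleCover.
Implicit Types (d : 'Z_2).

Definition par (b : bool) : 'Z_2 := b%:R.

Lemma odd_par b : odd (par b) = b.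
Proof. by case: b. Qed.

Lemma parK d : par (odd d) = d.
Proof. by case: d => -[|[|//]] i; apply: val_inj. Qed.

Lemma par_succ d : d + 1 = par (~~ odd d).
Proof. by case: d => -[|[|//]] i; apply: val_inj. Qed.

Lemma odd_succ2 d : odd (d + 1)%R = ~~ odd d.
Proof. by rewrite par_succ odd_par. Qed.

Lemma arcs2P (x y : X2 r s) :
  reflect (exists a, y = ((x.1.1 + sg a, x.1.2 + sg (a (+) odd x.2)), x.2 + 1))
          ((x, y) \in arcs2 r s).
Proof.
case: x => -[i j] d; rewrite inE /= -signr_odd -/(sg (odd d)) -(sgN s (odd d)).
apply: (iffP orP) => [[]/eqP->|[[] ->]].
- by exists false.
- by exists true.
- by right.
- by left.
Qed.

Lemma grp2_arc_part :
  grp (pair2 r s) \subset @arc_part (pair2 r s) _ (fun x => part1 x.1).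
Proof.
rewrite gen_subG; apply/subsetP=> h hS.
apply: (@arc_part_intro (pair2 r s)) => u v; last first.
  by case/setUP: hS => [/setUP[/set2P[]|/set1P]|/set1P] ->;
    rewrite !permE /part1 /= => ->.
case/arcs2P=> a ->.
case/setUP: hS => [/setUP[/set2P[]|/set1P]|/set1P] ->; rewrite !permE; apply/arcs2P.
- by exists a; rewrite /mu2_fun /mu_fun /= addrAC.
- by exists a; rewrite /nu2_fun /nu_fun /=; do 2!congr pair; rewrite addrAC.
- by exists a; rewrite /sigma2_fun /= odd_succ2 addbN sgN opprD.
- by exists (~~ a); rewrite /tau2_fun /tau_fun /= addNb !sgN !opprD.
Qed.

Lemma grp2_arc_transitive : @arc_transitive (pair2 r s) (grp (pair2 r s)).
Proof.
have mu_in : perm (@mu2_inj r s) \in grp (pair2 r s).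
  by apply: mem_gen; rewrite !inE eqxx.
have nu_in : perm (@nu2_inj r s) \in grp (pair2 r s).
  by apply: mem_gen; rewrite !inE eqxx orbT.
have sigma_in : perm (@sigma2_inj r s) \in grp (pair2 r s).
  by apply: mem_gen; rewrite !inE eqxx !orbT.
have tau_in : perm (@tau2_inj r s) \in grp (pair2 r s).
  by apply: mem_gen; rewrite !inE eqxx !orbT.
apply: (@arc_transitive_intro (pair2 r s) _ _ _ (((0, 0), 0) : X2 r s)
  (((1, 1), 1) : X2 r s) (perm (@tau2_inj r s)) grp2_arc_part) => [u||| w].
- have muX n (x : X2 r s) :
  (perm (@mu2_inj r s) ^+ n)%g x = ((x.1.1 + n%:R, x.1.2), x.2).
    elim: n => [|n IHn]; first by rewrite perm1 addr0; case: x => -[].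
    by rewrite expgSr permM IHn permE /mu2_fun /mu_fun /= -addrA natr1.
  have nuX n (x : X2 r s) : (perm (@nu2_inj r s) ^+ n)%g x = ((x.1.1,
    x.1.2 + n%:R), x.2).
    elim: n => [|n IHn]; first by rewrite perm1 addr0; case: x => -[].
    by rewrite expgSr permM IHn permE /nu2_fun /nu_fun /= -addrA natr1.
  have siX (b : bool) : (perm (@sigma2_inj r s) ^+ b)%g (((0, 0), 0) : X2 r s)
      = ((0, 0), par b).
    by case: b; rewrite ?perm1 // expg1 permE /sigma2_fun /= oppr0 add0r.
  (* The layer is chosen first, while the base point (0, 0) is still fixed by the reflection;
     translations then preserve the layer. *)
  exists (perm (@sigma2_inj r s) ^+ odd u.2 * (perm (@mu2_inj r s) ^+ u.1.1 *
     perm (@nu2_inj r s) ^+ u.1.2))%g.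
    by rewrite !groupM ?groupX.
  rewrite permM siX permM muX nuX /= !add0r !natr_Zp parK.
  by case: (u) => -[].
- exact: tau_in.
- by rewrite permE /tau2_fun /tau_fun /= !oppr0.
- case/arcs2P=> -[] ->; [right | left];
    by rewrite ?permE /tau2_fun /tau_fun /sg /= !add0r ?expr0 ?expr1.
Qed.

End DoubleCover.
End Models.

(** * The six lines *)

(** The orientation of the second quotient is tied to [c2], a coordinate on the covering pair, so
    that it can be compared with that of [M]. *)
Definition realises (P L : gpair) r s (c2 : P -> 'Z_s) : Prop :=
  exists N' M' : {group {perm L}},
  [/\ OG4 L, normal_cover P L, independent_cyclic_quotients N' M' r s,
      N' :&: M' = 1
    & (oriented c2 -> G_oriented M') /\ (unoriented c2 -> ~ G_oriented M')].

Section Lines.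
Local Open Scope ring_scope.
Variables (P : gpair) (N M : {group {perm P}}) (r s : nat).
Hypotheses (HP : OG4 P) (r3 : (3 <= r)%N) (s3 : (3 <= s)%N).
Hypotheses (nNG : N <| grp P) (nMG : M <| grp P).
Variables (c1 : P -> 'Z_r) (c2 : P -> 'Z_s).
Hypotheses (Hc1 : is_coord N c1) (Hc2 : is_coord M c2).
Hypothesis loc : forall x y y',
  adj x y -> adj x y' -> c1 y = c1 y' -> c2 y = c2 y' -> y = y'.
Hypothesis u1 : unoriented c1.
Variable x0 : P.
Hypotheses (z1 : c1 x0 = 0) (z2 : c2 x0 = 0).
Local Notation K := (orbker_group N :&: orbker_group M)%G.
Let r1 : (1 < r)%N := ltnW r3.
Let s1 : (1 < s)%N := ltnW s3.

Definition phi x : X r s := (c1 x, c2 x).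

Lemma phi_adj x y : adj x y -> adjX (phi x) (phi y).
Proof.
move=> xy; have [a c1y] := coord_step Hc1 xy; have [b c2y] := coord_step Hc2 xy.
by apply/adjXP; exists a, b; rewrite /phi c1y c2y.
Qed.

Lemma phi_lift x v : adjX (phi x) v -> exists2 y, adj x y & phi y = v.
Proof.
case/adjXP=> a [b ->]; have [y [xy c1y c2y]] := lift_nbr HP Hc2 loc u1 x a b.
by exists y; rewrite // /phi c1y c2y.
Qed.

Lemma phi_eq x y : phi x = phi y <-> c1 x = c1 y /\ c2 x = c2 y.
Proof. by split=> [[]|[e1 e2]]; rewrite // /phi e1 e2. Qed.

Lemma phi_reach (m n : nat) : odd m = odd n ->
  exists p, c1 p = m%:R /\ c2 p = n%:R.
Proof.
move=> mn; have [p [p1 p2 _]] := reach HP Hc2 loc u1 (Q := fun _ _ => True)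
  z1 z2 I (fun _ _ _ _ _ => I) mn.
by exists p.
Qed.

(** A walk reaches all pairs of integers of equal parity; an odd modulus allows one representative
    to be adjusted to the parity of the other. *)
Lemma phi_surj : odd r || odd s -> forall u, exists x, phi x = u.
Proof.
move=> rs [i j].
suff [m [n [mn mi nj]]] : exists m n, [/\ odd m = odd n, m%:R = i & n%:R = j].
  by have [p [p1 p2]] := phi_reach mn; exists p; rewrite /phi p1 p2 mi nj.
case/orP: rs => [r_odd|s_odd].
  have [m mj mi] := Zp_parity_repr i (odd j) r1 r_odd.
  by exists m, j; rewrite natr_Zp.
have [n ni nj] := Zp_parity_repr j (odd i) s1 s_odd.
by exists i, n; rewrite natr_Zp.
Qed.

Lemma phi_Xplus : ~~ odd r -> ~~ odd s -> forall x, Xplus (phi x).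
Proof.
move=> r_even s_even; apply: (conn_ind HP (x := x0)); first by rewrite /phi z1 z2.
move=> x y xx xy; have [a c1y] := coord_step Hc1 xy;
  have [b c2y] := coord_step Hc2 xy.
move: xx; rewrite /phi !XplusE c1y c2y (odd_Zp_sg r1 r_even) (odd_Zp_sg s1 s_even).
by case: (odd _) (odd _) => [] [].
Qed.

Section EvenEven.
Hypotheses (r_even : ~~ odd r) (s_even : ~~ odd s).

Definition phi_plus x : Xp r s := exist _ (phi x) (phi_Xplus r_even s_even x).

Lemma phi_plus_eq x y : phi_plus x = phi_plus y <-> phi x = phi y.
Proof. by split=> [/(congr1 val)//|e]; apply: val_inj. Qed.

Lemma phi_plus_lift x (v : Xp r s) : adjXp (phi_plus x) v ->
  exists2 y, adj x y & phi_plus y = v.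
Proof. by case/phi_lift=> y xy e; exists y => //; apply: val_inj. Qed.

Lemma phi_plus_surj (u : Xp r s) : exists x, phi_plus x = u.
Proof.
case: u => [[i j] ij]; have [p [p1 p2]] := phi_reach (eqP ij).
by exists p; apply: val_inj; rewrite /= /phi p1 p2 !natr_Zp.
Qed.

End EvenEven.

Section Oriented.
Hypothesis o2 : forall x y, darc true x y -> c2 y = c2 x + sg false.

Lemma phi_arcsG x y : adj x y ->
  ((phi x, phi y) \in arcsG r s) = ((x, y) \in arcs P).
Proof.
move=> xy; rewrite (oriented_arcs HP s3 o2 xy); apply/arcsGP/eqP.
  by case=> a [_ ->].
by move=> c2y; have [a c1y] := coord_step Hc1 xy; exists a; rewrite /phi c1y c2y.
Qed.

Lemma phi_orbit_oriented x y : phi x = phi y <-> y \in orbit 'P K x.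
Proof.
exact: iff_trans (phi_eq x y) (iff_sym (oriented_orbit HP nNG nMG Hc1 Hc2 u1 o2
  x y)).
Qed.

Lemma arcsG_adj (u v : X r s) : (u, v) \in arcsG r s -> adjX u v.
Proof. by case/arcsGP=> a ->; apply/adjXP; exists a, false. Qed.

Lemma line1 : odd r || odd s -> realises (pairG r s) r c2.
Proof.
move=> rs; apply: (model_realised HP r3 s3 nNG nMG Hc1 Hc2 (f := phi)
  (d1 := @part1 r s) (d2 := @part2 r s) _ _ loc _ _ _ _ _ _ x0 u1) => //.
- exact: phi_adj.
- exact: phi_lift.
- exact: phi_arcsG.
- exact: arcsG_adj.
- exact: phi_surj.
- exact: phi_orbit_oriented.
- exact: grpG_arc_part.
- exact: grpG_arc_transitive.
Qed.

Lemma line2 : ~~ odd r && ~~ odd s -> realises (pairGplus r s) r c2.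
Proof.
case/andP=> r_even s_even; apply: (model_realised HP r3 s3 nNG nMG Hc1 Hc2
  (f := phi_plus r_even s_even) (d1 := fun u => part1 (val u))
  (d2 := fun u => part2 (val u)) _ _ loc _ _ _ _ _ _ x0 u1) => //.
- exact: phi_adj.
- exact: phi_plus_lift.
- by move=> x y xy; rewrite inE phi_arcsG.
- by move=> u v; rewrite inE => /arcsG_adj.
- exact: phi_plus_surj.
- move=> x y; apply: iff_trans (phi_plus_eq _ _ x y) _; exact: phi_orbit_oriented.
- exact: grpGplus_arc_part.
- exact: grpGplus_arc_transitive.
Qed.

End Oriented.

Section Unoriented.
Hypothesis u2 : unoriented c2.
Local Notation vt := (vtype c1 c2).
Hypothesis t0 : vt x0 = false.

Lemma vt_flip x y : adj x y -> vt y = ~~ vt x.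
Proof. exact: (vtype_flip HP r3 s3 Hc1 Hc2 loc u1 u2). Qed.

Lemma vt_parity1 : ~~ odd r -> forall x, vt x = odd (c1 x).
Proof.
move=> r_even; apply: (conn_ind HP (x := x0)); first by rewrite t0 z1.
move=> x y tx xy; have [a c1y] := coord_step Hc1 xy.
by rewrite (vt_flip xy) tx c1y odd_Zp_sg.
Qed.

Lemma vt_parity2 : ~~ odd s -> forall x, vt x = odd (c2 x).
Proof.
move=> s_even; apply: (conn_ind HP (x := x0)); first by rewrite t0 z2.
move=> x y tx xy; have [a c2y] := coord_step Hc2 xy.
by rewrite (vt_flip xy) tx c2y odd_Zp_sg.
Qed.

Lemma phi_arc_sign x y : adj x y ->
  (exists a, phi y = (c1 x + sg a, c2 x + sg (a (+) vt x))) <->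
  (x, y) \in arcs P.
Proof.
move=> xy; have [a c1y] := coord_step Hc1 xy; have [b c2y] := coord_step Hc2 xy.
rewrite (vtype_arcs HP r3 s3 Hc2 loc u1 u2 xy c1y c2y) /phi c1y c2y.
split=> [[a' /eqP]|/eqP <-].
  rewrite xpair_eqE => /andP[/eqP/(sg_neq r3) -> /eqP/(sg_neq s3) ->].
  by rewrite addbA addbb.
by exists a; rewrite addbA addbb.
Qed.

Lemma phi_arcsH : ~~ odd s -> forall x y, adj x y ->
  ((phi x, phi y) \in arcsH r s) = ((x, y) \in arcs P).
Proof.
move=> s_even x y xy; apply/arcsHP/idP; rewrite /= -(vt_parity2 s_even) => h.
  by apply/(phi_arc_sign xy).
by apply/(phi_arc_sign xy).
Qed.

Lemma phi_orbit_unoriented : (forall x y, phi x = phi y -> vt x = vt y) ->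
  forall x y, phi x = phi y <-> y \in orbit 'P K x.
Proof.
move=> tE x y; apply: iff_trans (iff_sym (unoriented_orbit HP r3 s3 nNG nMG Hc1
  Hc2 loc u1 u2 x y)).
split=> [e|[e1 e2 _]]; last by apply/phi_eq.
by have [e1 e2] := (phi_eq x y).1 e; split=> //; apply: tE.
Qed.

Lemma arcsH_adj r' s' (u v : X r' s') : (u, v) \in arcsH r' s' -> adjX u v.
Proof. by case/arcsHP=> a ->; apply/adjXP; exists a, (a (+) odd u.2). Qed.

Lemma line3 : odd r && ~~ odd s -> realises (pairH r s) r c2.
Proof.
case/andP=> r_odd s_even; apply: (model_realised HP r3 s3 nNG nMG Hc1 Hc2 (f := phi)
  (d1 := @part1 r s) (d2 := @part2 r s) _ _ loc _ _ _ _ _ _ x0 u1) => //.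
- exact: phi_adj.
- exact: phi_lift.
- exact: phi_arcsH.
- exact: arcsH_adj.
- by apply: phi_surj; rewrite r_odd.
- by apply: phi_orbit_unoriented => x y [_ e]; rewrite !vt_parity2 ?e.
- exact: grpH_part1.
- exact: grpH_arc_transitive.
Qed.

Lemma line4 : ~~ odd r && odd s -> realises (pairH s r) r c2.
Proof.
case/andP=> r_even s_odd; pose swap (u : X r s) : X s r := (u.2, u.1).
have adj_swap u v : adjX (swap u) (swap v) = adjX u v by rewrite /adjX andbC.
apply: (model_realised HP r3 s3 nNG nMG Hc1 Hc2 (f := fun x => swap (phi x))
  (d1 := @part2 s r) (d2 := @part1 s r) _ _ loc _ _ _ _ _ _ x0 u1) => //.
- by move=> x y xy; rewrite adj_swap phi_adj.
- move=> x [j i]; rewrite (adj_swap (phi x) (i, j)) => /phi_lift[y xy e].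
  by exists y; rewrite ?e.
(* [arcsH] indexes an out-neighbour by the step of its first component, here [c2], while
   [phi_arc_sign] uses the step of [c1]; the two differ by the type. *)
- move=> x y xy; apply/arcsHP/idP; rewrite /= -(vt_parity1 r_even).
    case=> a [e2 e1]; apply/(phi_arc_sign xy); exists (a (+) vt x).
    by rewrite /phi e1 e2 -addbA addbb addbF.
  case/(phi_arc_sign xy)=> a [e1 e2]; exists (a (+) vt x).
  by rewrite /swap /phi /= e1 e2 -addbA addbb addbF.
- exact: arcsH_adj.
- move=> [j i]; have [|x e] := phi_surj _ (i, j); first by rewrite s_odd orbT.
  by exists x; rewrite e.
- move=> x y; apply: iff_trans (phi_orbit_unoriented _ x y); last first.
    by move=> {}x {}y [e _]; rewrite !vt_parity1 ?e.
  by split=> [[e2 e1]|->] //; rewrite /phi e1 e2.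
- exact: grpH_part2.
- exact: grpH_arc_transitive.
Qed.

Lemma line5 : ~~ odd r && ~~ odd s -> realises (pairHplus r s) r c2.
Proof.
case/andP=> r_even s_even; apply: (model_realised HP r3 s3 nNG nMG Hc1 Hc2
  (f := phi_plus r_even s_even) (d1 := fun u => part1 (val u))
  (d2 := fun u => part2 (val u)) _ _ loc _ _ _ _ _ _ x0 u1) => //.
- exact: phi_adj.
- exact: phi_plus_lift.
- by move=> x y xy; rewrite inE phi_arcsH.
- by move=> u v; rewrite inE => /arcsH_adj.
- exact: phi_plus_surj.
- move=> x y; apply: iff_trans (phi_plus_eq _ _ x y) _.
  apply: phi_orbit_unoriented => {}x {}y [_ e].
  by rewrite !vt_parity2 ?e.
- exact: grpHplus_arc_part.
- exact: grpHplus_arc_transitive.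
Qed.

Lemma line6 : odd r && odd s -> realises (pair2 r s) r c2.
Proof.
case/andP=> r_odd s_odd; pose f x : X2 r s := (phi x, par (vt x)).
have fE x y : f x = f y <-> y \in orbit 'P K x.
  apply: iff_trans (iff_sym (unoriented_orbit HP r3 s3 nNG nMG Hc1 Hc2 loc u1
    u2 x y)).
  split=> [[e1 e2 /(congr1 (fun d : 'Z_2 => odd d))]|[e1 e2 e3]].
    by rewrite !odd_par.
  by rewrite /f /phi e1 e2 e3.
apply: (model_realised HP r3 s3 nNG nMG Hc1 Hc2 (f := f) (d1 := fun u => part1 u.1)
  (d2 := fun u => part2 u.1) _ _ loc _ _ _ _ _ _ x0 u1) => //.
- move=> x y xy; rewrite /adjX2 /= phi_adj // (vt_flip xy) andbT.
  by case: (vt x).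
- move=> x [v d] /andP[/= dx /phi_lift[y xy e]]; exists y => //.
  rewrite /f e (vt_flip xy); congr pair; rewrite -(parK d); congr par.
  by move: dx; rewrite -{1}(parK d); case: (vt x) (odd d) => [] [].
- move=> x y xy; apply/arcs2P/idP; rewrite /= odd_par.
    by case=> a [e1 e2 _]; apply/(phi_arc_sign xy); exists a; rewrite /phi e1 e2.
  case/(phi_arc_sign xy)=> a e; exists a.
  by rewrite /f e (vt_flip xy) par_succ odd_par.
- move=> u v /arcs2P[a ->]; apply/andP; split=> /=.
    by rewrite -{1}(parK u.2) par_succ; case: (odd _).
  by apply/adjXP; exists a, (a (+) odd u.2).
- move=> [[i j] d].
  have [m md mi] := Zp_parity_repr i (odd d) r1 r_odd.
  have [n nd nj] := Zp_parity_repr j (odd d) s1 s_odd.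
  have mn : odd m = odd n by rewrite md nd.
  (* Taking the type for [Q] makes the layer reached the parity of [m], which was chosen to be that
     of [d]. *)
  have [x y b <- xy|p [p1 p2 pt]] := reach HP Hc2 loc u1 (Q := fun p b => vt p
    = b) z1 z2 t0 _ mn.
    exact: vt_flip.
  by exists p; rewrite /f /phi p1 p2 pt mi nj md parK.
- exact: grp2_arc_part.
- exact: grp2_arc_transitive.
Qed.

End Unoriented.
End Lines.

(** * Assembling the cases *)

Lemma pair_isomorphic_refl (L : gpair) : pair_isomorphic L L.
Proof.
exists id, (idm_morphism (grp L)); split=> //; first by exists id.
by apply/isomP; split; [exact: injm_idm | exact: morphim_idm].
Qed.

(** Both quotients are compared with the same [c2], so one case distinction settles both
    equivalences with the line number. *)
Lemma realises_line (P : gpair) (M : {group {perm P}}) r s (c2 : P -> 'Z_s) k L :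
  table_line r s k L -> realises L r c2 ->
  oriented c2 /\ G_oriented M /\ (k = 1%N \/ k = 2%N) \/
  unoriented c2 /\ ~ G_oriented M /\ ~ (k = 1%N \/ k = 2%N) ->
  exists (Q : gpair) (N' M' : {group {perm Q}}),
  [/\ OG4 Q, normal_cover P Q, independent_cyclic_quotients N' M' r s,
      N' :&: M' = 1
    & exists (k : nat) (L : gpair),
      [/\ table_line r s k L, pair_isomorphic Q L,
          G_oriented M' <-> k = 1%N \/ k = 2%N
        & G_oriented M <-> k = 1%N \/ k = 2%N]].
Proof.
move=> lineL [N' [M' [og cover indep NM [or un]]]] H.
exists L, N', M'; split=> //; exists k, L; split=> //.
- exact: pair_isomorphic_refl.
- case: H => [[/or o [_ hk]]|[/un nu [_ hk]]]; first by split.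
  by split=> // /nu.
- case: H => [[_ [o hk]]|[_ [nu hk]]]; first by split.
  by split=> // /nu.
Qed.

Unset Implicit Arguments.

Theorem theorem2 (P : gpair) (x : P) (N M : {group {perm P}}) (r s : nat) :
  OG4 P -> 3 <= r -> 3 <= s ->
  independent_cyclic_quotients N M r s ->
  [/\ 'C_(grp P)[x | 'P] \isog Zp 2,
      ~ G_oriented N \/ ~ G_oriented M
    & ~ G_oriented N ->
      exists (Q : gpair) (N' M' : {group {perm Q}}),
      [/\ OG4 Q,
          normal_cover P Q,
          independent_cyclic_quotients N' M' r s,
          N' :&: M' = 1
        & exists (k : nat) (L : gpair),
          [/\ table_line r s k L,
              pair_isomorphic Q L,
              G_oriented M' <-> k = 1%N \/ k = 2%N
            & G_oriented M <-> k = 1%N \/ k = 2%N]]].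
Proof.
move=> HP r3 s3 [nNG nMG qN qM indep].
have [c1 Hc1] := cycle_coord HP r3 (normal_sub nNG) (cycle_no_edge HP r3 nNG qN) qN.
have [c2 Hc2] := cycle_coord HP s3 (normal_sub nMG) (cycle_no_edge HP s3 nMG qM) qM.
have loc := independent_loc HP r3 s3 nNG nMG Hc1 Hc2 indep.
(* If both coordinates were oriented, the two out-neighbours of [x] would agree in both and hence
   coincide. *)
have NM_unor : unoriented c1 \/ unoriented c2.
  have [[e1 o1]|u1] := coord_dichotomy HP r3 nNG Hc1; last by left.
  have [[e2 o2]|u2] := coord_dichotomy HP s3 nMG Hc2; last by right.
  have [y [z [yz xy xz _]]] := dir_two HP true x; case/eqP: yz.
  by apply: (loc _ _ _ (darc_adj HP xy) (darc_adj HP xz));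
    rewrite ?(o1 _ _ xy) ?(o1 _ _ xz) ?(o2 _ _ xy) ?(o2 _ _ xz).
split.
- case: NM_unor => u.
    exact: (stab_Zp2 HP nNG Hc1 x u).
  exact: (stab_Zp2 HP nMG Hc2 x u).
- case: NM_unor => u; [left | right].
    exact: (unoriented_not_G_oriented HP Hc1 x u).
  exact: (unoriented_not_G_oriented HP Hc2 x u).
move=> nNor.
have u1 : unoriented c1.
  by case: (coord_dichotomy HP r3 nNG Hc1) => // o; case: nNor;
    apply: (oriented_G_oriented HP r3 Hc1 o).
have [y [xy c1y _]] := u1 x true false.
have [a c2y] := coord_step Hc2 (darc_adj HP xy).
(* The coordinates are normalised so that [x] lies over (0, 0) and its out-neighbour [y] over (1,
   1). An oriented [b2] then increases along arcs, and in the unoriented case [x] has type [false],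
   as the lines require. *)
pose b1 z : 'Z_r := (sg false * (c1 z - c1 x))%R.
pose b2 z : 'Z_s := (sg a * (c2 z - c2 x))%R.
have Hb1 : is_coord N b1 := coord_affine Hc1 false (c1 x).
have Hb2 : is_coord M b2 := coord_affine Hc2 a (c2 x).
have b1x : b1 x = 0%R by rewrite /b1 subrr mulr0.
have b2x : b2 x = 0%R by rewrite /b2 subrr mulr0.
have b1y : b1 y = (b1 x + sg false)%R.
  by rewrite b1x add0r /b1 c1y addrAC subrr add0r sg_mul.
have b2y : b2 y = (b2 x + sg false)%R.
  by rewrite b2x add0r /b2 c2y addrAC subrr add0r sg_mul addbb.
have bloc := independent_loc HP r3 s3 nNG nMG Hb1 Hb2 indep.
have bu1 : unoriented b1.
  by case: (coord_dichotomy HP r3 nNG Hb1) => // o; case: nNor;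
    apply: (oriented_G_oriented HP r3 Hb1 o).
have [[e o2]|u2] := coord_dichotomy HP s3 nMG Hb2.
  have e0 : e = false by move: (o2 _ _ xy); rewrite b2y => /(sg_neq s3) <-.
  rewrite e0 in o2; have or2 : oriented b2 by exists false.
  have M_or := oriented_G_oriented HP s3 Hb2 or2.
  have [rs|] := boolP (odd r || odd s).
    apply: (realises_line (M := M) (c2 := b2) (Line1 rs)); last by left;
      split=> //; split; [|left].
    exact: (line1 HP r3 s3 nNG nMG Hb1 Hb2 bloc bu1 b1x b2x o2 rs).
  rewrite negb_or => rs.
  apply: (realises_line (M := M) (c2 := b2) (Line2 rs)); last by left;
    split=> //; split; [|right].
  exact: (line2 HP r3 s3 nNG nMG Hb1 Hb2 bloc bu1 b1x b2x o2 rs).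
have t0 : vtype b1 b2 x = false.
  have := vtypeP HP r3 s3 Hb2 bloc bu1 u2 xy b1y; rewrite b2y => /(sg_neq s3).
  by rewrite addFb addbF.
have M_un := unoriented_not_G_oriented HP Hb2 x u2.
have side k : k != 1%N -> k != 2%N ->
    oriented b2 /\ G_oriented M /\ (k = 1%N \/ k = 2%N) \/
    unoriented b2 /\ ~ G_oriented M /\ ~ (k = 1%N \/ k = 2%N).
  by move=> /eqP k1 /eqP k2; right; split=> //; split=> // -[].
have [ro|re] := boolP (odd r); have [so|se] := boolP (odd s).
- have rs : odd r && odd s by rewrite ro so.
  apply: (realises_line (M := M) (c2 := b2) (Line6 rs)); last exact: side.
  exact: (line6 HP r3 s3 nNG nMG Hb1 Hb2 bloc bu1 b1x b2x u2 t0 rs).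
- have rs : odd r && ~~ odd s by rewrite ro se.
  apply: (realises_line (M := M) (c2 := b2) (Line3 rs)); last exact: side.
  exact: (line3 HP r3 s3 nNG nMG Hb1 Hb2 bloc bu1 b1x b2x u2 t0 rs).
- have rs : ~~ odd r && odd s by rewrite re so.
  apply: (realises_line (M := M) (c2 := b2) (Line4 rs)); last exact: side.
  exact: (line4 HP r3 s3 nNG nMG Hb1 Hb2 bloc bu1 b1x b2x u2 t0 rs).
have rs : ~~ odd r && ~~ odd s by rewrite re se.
apply: (realises_line (M := M) (c2 := b2) (Line5 rs)); last exact: side.
exact: (line5 HP r3 s3 nNG nMG Hb1 Hb2 bloc bu1 b1x b2x u2 t0 rs).
Qed.
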